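(* The set $\Pi^{(3)}_{\mathrm{vvv},\infty}=\{\pi_{\mathrm{vvv}}(\mathcal{F}) : \mathcal{F}\text{ is a family of }3\text{-graphs}\}\subseteq[0,1]$ of all uniform Turán densities of families of $3$-graphs is not well-ordered (with respect to the usual order $\leq$ on the reals).
   Context: A $3$-graph $H=(V,E)$ consists of a finite vertex set $V$ and an edge set $E\subseteq V^{(3)}$, where $U^{(k)}=\{e\subseteq U : |e|=k\}$ for a set $U$. A family of $3$-graphs is a (possibly infinite) set of $3$-graphs; $H$ is $\mathcal{F}$-free if it contains no member of $\mathcal{F}$ as a (not necessarily induced) subhypergraph. For $d\in[0,1]$ and $\eta>0$, a $3$-graph $H=(V,E)$ is uniformly $(d,\eta)$-dense if $|U^{(3)}\cap E|\geq d\binom{|U|}{3}-\eta|V|^3$ for every $U\subseteq V$. For a family $\mathcal{F}$ of $3$-graphs, the uniform Turán density $\pi_{\mathrm{vvv}}(\mathcal{F})$ is the supremum of all $d\in[0,1]$ such that for every $\eta>0$ and every $n\in\mathbb{N}$ there is an $\mathcal{F}$-free, uniformly $(d,\eta)$-dense $3$-graph $H$ with $|V(H)|\geq n$. *)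

(* Defs.v *)
From HB Require Import structures.
From mathcomp Require Import all_boot all_order all_algebra.
From mathcomp Require Import all_classical all_reals.

Set Implicit Arguments.
Unset Strict Implicit.
Unset Printing Implicit Defensive.
Import Order.TTheory GRing.Theory Num.Theory.

Local Open Scope classical_set_scope.
Local Open Scope ring_scope.

(* U^(k) *)
Definition ksubsets (V : finType) (U : {set V}) (k : nat) : {set {set V}} :=
  [set e : {set V} | (e \subset U) && (#|e| == k)]%SET.

Record hgraph3 := HGraph3 {
  vertices : finType;
  edges : {set {set vertices}};
  edges_sub : edges \subset ksubsets [set: vertices]%SET 3
}.

(* Not [set hgraph3]: the universe of finite types exceeds that of [set]. *)
Definition family3 := hgraph3 -> Prop.

(* H contains a copy of F, not necessarily induced. *)
Definition contains (H F : hgraph3) : Prop :=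
  exists2 f : vertices F -> vertices H, injective f &
    forall e : {set vertices F}, e \in edges F -> (f @: e)%SET \in edges H.

Definition family_free (F : family3) (H : hgraph3) : Prop :=
  forall G : hgraph3, F G -> ~ contains H G.

Definition uniformly_dense (R : realType) (d eta : R) (H : hgraph3) : Prop :=
  forall U : {set vertices H},
    d * 'C(#|U|, 3)%:R - eta * #|vertices H|%:R ^+ 3
      <= #|(ksubsets U 3 :&: edges H)%SET|%:R.

Definition admissible_density (R : realType) (F : family3) : set R :=
  [set d : R | 0 <= d <= 1 /\
    forall (eta : R) (n : nat), 0 < eta ->
      exists H : hgraph3,
        [/\ family_free F H, uniformly_dense d eta H &
            (n <= #|vertices H|)%N] ].

(* The set of admissible densities is empty when F contains an edgeless
   3-graph (an F-free 3-graph then has bounded order); its supremum in [0, 1]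
   is then 0, and indeed sup set0 = 0. *)
Definition pi_vvv (R : realType) (F : family3) : R :=
  sup (@admissible_density R F).

Definition Pi_vvv_infty (R : realType) : set R :=
  [set x : R | exists F : family3, x = pi_vvv R F].

Arguments Pi_vvv_infty : clear implicits.

Lemma Pi_vvv_infty_sub (R : realType) (x : R) :
  Pi_vvv_infty R x -> 0 <= x <= 1.
Proof.
move=> [F ->]; rewrite /pi_vvv.
have ub1 : ubound (@admissible_density R F) 1 by move=> d [/andP[]].
have [->|/set0P[d dF]] := eqVneq (@admissible_density R F) set0.
  by rewrite sup0 lexx ler01.
rewrite (ge_sup _ ub1) ?andbT; last by exists d.
have [/andP[d0 _] _] := dF.
apply: (le_trans d0); apply: ub_le_sup dF.
by exists 1.
Qed.

(* wo_chain quantifies over boolean predicates; this is its reading on sets. *)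
Lemma wo_chain_leP (R : realType) (S : set R) :
  wochoice.wo_chain <=%R (mem S) <->
  forall A : set R, A `<=` S -> A !=set0 -> exists2 m, A m & lbound A m.
Proof.
split=> [woS A AS [a Aa]|woS].
  have sub : {subset mem A <= mem S}.
    by move=> x; rewrite !inE => /AS.
  have [|m [[Am mA] _]] := woS (mem A) sub.
    by exists a; rewrite !inE.
  exists m; first by move: Am; rewrite !inE.
  by move=> x Ax; apply: mA; rewrite !inE.
apply: wochoice.antisymmetric_wo_chain => [x y _ _|A AS [a Aa]].
  exact: le_anti.
have [||m Am mA] := woS [set` A].
- by move=> x /= /AS; rewrite !inE.
- by exists a.
- by exists m; split=> // x Ax; apply: mA.
Qed.

(* Main.v *)
(** A palette is a set A of triples of colours from a finite set C.  Let F_A be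
the family of the 3-graphs H that are not A-colourable, where a colouring
consists of an order on V(H) and a colour for every pair such that the colours
(uv, uw, vw) of each edge u < v < w form a triple in A.  Its uniform Turan density
is the maximum over the simplex of the cubic form sum_A x_a x_b x_c.  A
random colouring of the pairs gives the lower bound.  For the upper bound, take
many measures on consecutive intervals of V(H) such that the pairs between them
are regular in every colour (energy increment), make the colour densities
between them nearly constant (Ramsey), and count edges.

It remains to find palettes whose cubic forms have maxima that are all larger
than their infimum 10/27.  Take a special colour of weight z together with
blocks of weights Y_0, ..., Y_k and total s, and let each allowed triple contain
the special colour exactly once.  The multiplicities are chosen such that, when
the weight of each block is spread evenly, the cubic form is
  z/2 * (5 s^2 - (sum_j (2 Y_(j+1) - Y_j)^2 - Y_k^2) / 2).
The second factor is maximal near Y_j proportional to 2^-j, where the squares vanish and only the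
gain Y_k^2, which is exponentially small in k, is left. *)

Require Import Defs.
From mathcomp Require Import all_boot all_order all_algebra.
From mathcomp Require Import all_classical all_reals.
From mathcomp Require Import zify ring lra.

Set Implicit Arguments.
Unset Strict Implicit.
Unset Printing Implicit Defensive.
Import Order.TTheory GRing.Theory Num.Theory.

Local Open Scope ring_scope.

(** * Palettes and sums over triples *)

(** The vertex order is encoded by an injective rank [r], and the colour of a pair is read off as
    [phi u v] with [u] the vertex of smaller rank. *)
Definition colorable (C : finType) (A : C -> C -> C -> bool) (H : hgraph3) : Prop :=
  exists r : vertices H -> nat, injective r /\
  exists phi : vertices H -> vertices H -> C,
    forall u v w, (r u < r v < r w)%N -> [set u; v; w]%SET \in edges H ->
      A (phi u v) (phi u w) (phi v w).

Definition uncolorable (C : finType) (A : C -> C -> C -> bool) : family3 :=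
  fun G => ~ colorable A G.

Lemma colorable_contains (C : finType) (A : C -> C -> C -> bool) (H G : hgraph3) :
  contains H G -> colorable A H -> colorable A G.
Proof.
move=> [f injf fE] [r [injr [phi phiA]]].
exists (r \o f); split; first exact: inj_comp.
exists (fun u v => phi (f u) (f v)) => u v w uvw /fE.
rewrite !imsetU !imset_set1; exact: phiA.
Qed.

(** An uncolourable [H] contains itself as a forbidden member, while colourability passes to every
    subhypergraph. *)
Lemma family_free_uncolorable (C : finType) (A : C -> C -> C -> bool) (H : hgraph3) :
  family_free (uncolorable A) H <-> colorable A H.
Proof.
split=> [Hfree|Hcol G Gunc HG]; last exact/Gunc/(colorable_contains HG).
apply: contrapT => /Hfree; apply; exists id => // e.
by rewrite imset_id.
Qed.

Section Triples.
Variables (V : finType) (r : V -> nat).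
Hypothesis injr : injective r.

Lemma sorted_triple_neq (u v w : V) :
  (r u < r v < r w)%N -> [/\ u != v, u != w & v != w].
Proof.
move=> /andP[uv vw]; have uw := ltn_trans uv vw.
by split; [move: uv|move: uw|move: vw]; apply: contraTneq => ->; rewrite ltnn.
Qed.

Lemma sorted_triple_inj (u v w u' v' w' : V) :
  (r u < r v < r w)%N -> (r u' < r v' < r w')%N ->
  [set u; v; w]%SET = [set u'; v'; w']%SET -> (u, v, w) = (u', v', w').
Proof.
move=> lt lt' eqT.
have: [:: u; v; w] = [:: u'; v'; w'].
  apply: (@irr_sorted_eq _ (relpre r ltn)).
  - by move=> y x z; apply: ltn_trans.
  - by move=> x /=; rewrite ltnn.
  - by rewrite /= andbT.
  - by rewrite /= andbT.
  move=> x; have /setP/(_ x) := eqT.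
  by rewrite !inE !orbA.
by case=> -> -> ->.
Qed.

Lemma card3_sorted (T : {set V}) : #|T| = 3 ->
  exists u v w, (r u < r v < r w)%N /\ T = [set u; v; w]%SET.
Proof.
move=> T3; pose s := sort (relpre r leq) (enum T).
have us : uniq s by rewrite sort_uniq enum_uniq.
have ss : sorted (relpre r leq) s.
  by apply: sort_sorted => x y; apply: leq_total.
have : size s = 3 by rewrite size_sort -cardE.
have memT : s =i T by move=> x; rewrite mem_sort mem_enum.
case: s us ss memT => [|u [|v [|w []]]] //= us ss memT _.
exists u, v, w; split.
  move: us; rewrite !inE negb_or andbT => /andP[/andP[uv uw] vw].
  case/and3P: ss => ruv rvw _.
  by rewrite !ltn_neqAle ruv rvw !(inj_eq injr) uv vw.
by apply/setP => x; rewrite -memT !inE orbA.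
Qed.

Lemma card_sorted_triple (u v w : V) :
  (r u < r v < r w)%N -> #|[set u; v; w]%SET| = 3.
Proof.
move=> /sorted_triple_neq[uv uw vw].
have vu1 : v \notin [set u]%SET by rewrite inE eq_sym.
have wuv : w \notin (v |: [set u])%SET by rewrite !inE negb_or !(eq_sym w) vw.
by rewrite (finset.setUC _ [set w]%SET) (finset.setUC [set u]%SET) !cardsU1 vu1 wuv cards1.
Qed.

(** Each 3-set has exactly one increasing enumeration. This links the density condition, a sum over
    3-sets, with palettes, which see ordered triples. *)
Lemma sum_card3 (R : realType) (f : {set V} -> R) :
  \sum_(T : {set V} | #|T| == 3) f T =
  \sum_u \sum_v \sum_(w | (r u < r v < r w)%N) f [set u; v; w]%SET.
Proof.
transitivity (\sum_(p : V * V * V | (r p.1.1 < r p.1.2 < r p.2)%N)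
    f [set p.1.1; p.1.2; p.2]%SET); last first.
  rewrite pair_bigA /=.
  by rewrite (pair_big_dep xpredT (fun p w => (r p.1 < r p.2 < r w)%N)
     (fun p w => f [set p.1; p.2; w]%SET)) /=.
rewrite (partition_big (fun p : V * V * V => [set p.1.1; p.1.2; p.2]%SET)
  (fun T => #|T| == 3)) /=; last first.
  by move=> [[u v] w] /= uvw; rewrite card_sorted_triple.
apply: eq_bigr => T /eqP /card3_sorted [u [v [w [uvw ->]]]].
rewrite (big_pred1 (u, v, w)) //= => -[[u' v'] w'] /=.
apply/andP/eqP => [[lt /eqP] | [-> -> ->] //].
exact: sorted_triple_inj.
Qed.

Lemma prod_triple (R : realType) (m : V -> R) u v w :
  (r u < r v < r w)%N -> \prod_(x in [set u; v; w]%SET) m x = m u * m v * m w.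
Proof.
move=> /sorted_triple_neq[uv uw vw].
rewrite (finset.setUC _ [set w]%SET) (finset.setUC [set u]%SET).
have vu1 : v \notin [set u]%SET by rewrite inE eq_sym.
have wuv : w \notin (v |: [set u])%SET by rewrite !inE negb_or !(eq_sym w) vw.
by rewrite !big_setU1 //= big_set1; ring.
Qed.

End Triples.

(** * Uniform density with vertex weights *)

Section WeightedDensity.
Variables (R : realType) (H : hgraph3).
Local Notation V := (vertices H).
Implicit Types (w : V -> R) (T : {set V}).

(** This is the probability that a random set with independent memberships contains [T]. *)
Lemma sum_random_subset w T :
  \sum_(U : {set V}) (\prod_v (if v \in U then w v else 1 - w v)) * (T \subset U)%:R
  = \prod_(v in T) w v.
Proof.
transitivity (\sum_(U : {set V}) \prod_v
    (if v \in U then w v else (1 - w v) * (v \notin T)%:R)).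
  apply: eq_bigr => U _; case: (boolP (T \subset U)) => [/fintype.subsetP TU|].
    rewrite mulr1; apply: eq_bigr => v _; case: ifPn => // vU.
    by rewrite (contra (TU v) vU) mulr1.
  move=> /subsetPn[v vT vU].
  by rewrite mulr0 (bigD1 v) //= (negbTE vU) vT /= mulr0 mul0r.
(* The sum over [U] is the expansion of a product over [v] whose factor is [w v] for [v] in [T] and
   [1] otherwise. *)
rewrite [RHS]big_mkcond -(bigA_distr _ _ w (fun v => (1 - w v) * (v \notin T)%:R)) /=.
by apply: eq_bigr => v _; case: (v \in T) => /=; ring.
Qed.

Lemma binomial_sum (U : {set V}) :
  'C(#|U|, 3)%:R = \sum_(T : {set V} | #|T| == 3) (T \subset U)%:R :> R.
Proof.
rewrite -cards_draws -!sum1_card !natr_sum big_mkcond [RHS]big_mkcond.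
by apply: eq_bigr => T _; rewrite !inE; case: (T \subset U); case: (#|T| == 3).
Qed.

Lemma card_induced_edges (U : {set V}) :
  #|(ksubsets U 3 :&: edges H)%SET|%:R =
  \sum_(T : {set V} | #|T| == 3) (T \in edges H)%:R * (T \subset U)%:R :> R.
Proof.
rewrite -!sum1_card !natr_sum big_mkcond [RHS]big_mkcond.
apply: eq_bigr => T _; rewrite !inE.
by case: (T \subset U); case: (#|T| == 3); case: (T \in _); rewrite /= ?mul1r ?mul0r.
Qed.

(* Average the density condition over the random set which contains each v
   independently with probability w v. *)
Lemma weighted_dense (d eta : R) w :
  uniformly_dense d eta H -> (forall v, 0 <= w v <= 1) ->
  d * (\sum_(T : {set V} | #|T| == 3) \prod_(v in T) w v) - eta * #|V|%:R ^+ 3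
  <= \sum_(T : {set V} | #|T| == 3) (T \in edges H)%:R * \prod_(v in T) w v.
Proof.
move=> Hd w01.
pose P (U : {set V}) := \prod_v (if v \in U then w v else 1 - w v) : R.
have P0 U : 0 <= P U.
  apply: prodr_ge0 => v _; have /andP[? ?] := w01 v.
  by case: ifP => // _; rewrite subr_ge0.
have P1 : \sum_(U : {set V}) P U = 1.
  have := sum_random_subset w finset.set0; rewrite big_set0 => <-.
  by apply: eq_bigr => U _; rewrite finset.sub0set mulr1.
have key (U : {set V}) : d * (\sum_(T : {set V} | #|T| == 3) (T \subset U)%:R)
    - eta * #|V|%:R ^+ 3
  <= \sum_(T : {set V} | #|T| == 3) (T \in edges H)%:R * (T \subset U)%:R.
  by rewrite -binomial_sum -card_induced_edges; apply: Hd.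
have := ler_sum (index_enum _) (fun U (_ : true) => ler_wpM2l (P0 U) (key U)).
under eq_bigr do rewrite mulrBr.
rewrite sumrB -mulr_suml P1 mul1r.
congr (_ - _ <= _).
  under eq_bigr do rewrite mulrCA mulr_sumr.
  rewrite -mulr_sumr exchange_big /=; congr (_ * _).
  by apply: eq_bigr => T _; rewrite -sum_random_subset.
under eq_bigr do rewrite mulr_sumr.
rewrite exchange_big /=; apply: eq_bigr => T _.
under eq_bigr do rewrite mulrCA.
by rewrite -mulr_sumr -sum_random_subset.
Qed.

End WeightedDensity.

(** * Regularity for measures *)

Section Regularity.
Variables (R : realType) (V C : finType) (phi : V -> V -> C).
Implicit Types (nu : V -> R) (F G : V -> R) (a b c : C) (eps : R).

Definition is_proba nu := (forall u, 0 <= nu u) /\ \sum_u nu u = 1.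

(** Both arguments may be signed: this bilinear form is also evaluated at perturbations of
    measures. *)
Definition dens a nu nu' : R :=
  \sum_u \sum_v nu u * nu' v * (phi u v == a)%:R.

(** A cut-norm condition in which functions into [[0, 1]] replace vertex subsets. *)
Definition regular eps nu nu' :=
  forall a F G, (forall u, 0 <= F u <= 1) -> (forall v, 0 <= G v <= 1) ->
  `|\sum_u \sum_v nu u * nu' v * (F u * G v * ((phi u v == a)%:R - dens a nu nu'))|
    <= eps.

Lemma proba_prod nu nu' : is_proba nu -> is_proba nu' ->
  \sum_u \sum_v nu u * nu' v = 1.
Proof.
move=> [_ s1] [_ s2]; rewrite -[RHS]s1; apply: eq_bigr => u _.
by rewrite -mulr_sumr s2 mulr1.
Qed.

Lemma dens_ge0 a nu nu' : is_proba nu -> is_proba nu' -> 0 <= dens a nu nu'.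
Proof.
by move=> [p _] [p' _]; do 2!apply: sumr_ge0 => ? _; rewrite !mulr_ge0.
Qed.

Lemma dens_le1 a nu nu' : is_proba nu -> is_proba nu' -> dens a nu nu' <= 1.
Proof.
move=> pn pn'; rewrite -(proba_prod pn pn').
have [p _] := pn; have [p' _] := pn'.
do 2!apply: ler_sum => ? _; rewrite ler_piMr ?mulr_ge0 //.
by case: eqP.
Qed.

Lemma sum_dens nu nu' : is_proba nu -> is_proba nu' -> \sum_a dens a nu nu' = 1.
Proof.
move=> pn pn'; rewrite -(proba_prod pn pn') /dens exchange_big /=.
apply: eq_bigr => u _; rewrite exchange_big /=; apply: eq_bigr => v _.
rewrite -mulr_sumr (bigD1 (phi u v)) //= eqxx big1 ?addr0 ?mulr1 // => a.
by rewrite eq_sym => /negbTE ->.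
Qed.

(** * Counting coloured triangles between regular pairs *)

Section Counting.
Variables (nu1 nu2 nu3 : V -> R) (eps : R).
Hypotheses (p1 : is_proba nu1) (p2 : is_proba nu2) (p3 : is_proba nu3).
Hypotheses (reg12 : regular eps nu1 nu2) (reg13 : regular eps nu1 nu3).

(** Replace the indicator on [uv] by its density, then the one on [uw]. With the third vertex fixed,
    the other indicators split into a function of each endpoint, so regularity bounds each
    replacement by [eps]. The indicator on [vw] then averages exactly to its density. *)
Lemma triangle_count a b c :
  \sum_u \sum_v \sum_w nu1 u * nu2 v * nu3 w *
     ((phi u v == a)%:R * (phi u w == b)%:R * (phi v w == c)%:R)
  <= dens a nu1 nu2 * dens b nu1 nu3 * dens c nu2 nu3 + 2 * eps.
Proof.
have bool01 (x : bool) : (0 : R) <= x%:R <= 1 by case: x; rewrite /= ?ler01 ?lexx.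
have one01 : (0 : R) <= 1 <= 1 by rewrite ler01 /=.
pose S1 w := \sum_u \sum_v nu1 u * nu2 v * ((phi u w == b)%:R * (phi v w == c)%:R *
   ((phi u v == a)%:R - dens a nu1 nu2)).
pose S2 v := \sum_u \sum_w nu1 u * nu3 w * (1 * (phi v w == c)%:R *
   ((phi u w == b)%:R - dens b nu1 nu3)).
have S1le w : S1 w <= eps.
  rewrite /S1; apply: le_trans (ler_norm _) _.
  by apply: (@reg12 a (fun u => (phi u w == b)%:R) (fun v => (phi v w == c)%:R)) => ?; apply: bool01.
have S2le v : S2 v <= eps.
  rewrite /S2; apply: le_trans (ler_norm _) _.
  by apply: (@reg13 b (fun => 1) (fun w => (phi v w == c)%:R)) => ?; [apply: one01 | apply: bool01].
have -> : \sum_u \sum_v \sum_w nu1 u * nu2 v * nu3 w *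
     ((phi u v == a)%:R * (phi u w == b)%:R * (phi v w == c)%:R) =
  \sum_w nu3 w * S1 w + dens a nu1 nu2 * \sum_v nu2 v * S2 v
  + dens a nu1 nu2 * dens b nu1 nu3 * dens c nu2 nu3.
  transitivity (\sum_u \sum_v \sum_w (nu3 w * (nu1 u * nu2 v * ((phi u w == b)%:R * (phi v w == c)%:R *
   ((phi u v == a)%:R - dens a nu1 nu2)))
   + dens a nu1 nu2 * (nu2 v * (nu1 u * nu3 w * (1 * (phi v w == c)%:R *
   ((phi u w == b)%:R - dens b nu1 nu3)))) +
   dens a nu1 nu2 * dens b nu1 nu3 * (nu1 u * (nu2 v * nu3 w * (phi v w == c)%:R)))).
    by do 3!apply: eq_bigr => ? _; ring.
  under eq_bigr do under eq_bigr do rewrite !big_split /=.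
  under eq_bigr do rewrite !big_split /=.
  rewrite !big_split /=; congr (_ + _ + _).
  - under eq_bigr do rewrite exchange_big /=.
    rewrite exchange_big /=; apply: eq_bigr => w _; rewrite mulr_sumr.
    by apply: eq_bigr => u _; rewrite mulr_sumr.
  - rewrite exchange_big /= mulr_sumr; apply: eq_bigr => v _.
    rewrite /S2 !mulr_sumr; apply: eq_bigr => u _.
    by rewrite !mulr_sumr; apply: eq_bigr => w _.
  - have -> : dens c nu2 nu3 = \sum_u nu1 u * dens c nu2 nu3.
      by rewrite -mulr_suml p1.2 mul1r.
    rewrite mulr_sumr; apply: eq_bigr => u _.
    set d1 := dens a _ _; set d2 := dens b _ _; rewrite /dens !mulr_sumr; apply: eq_bigr => v _.
    by rewrite !mulr_sumr; apply: eq_bigr => w _.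
have avg (nu S : V -> R) : is_proba nu -> (forall v, S v <= eps) -> \sum_v nu v * S v <= eps.
  move=> [pos s1] Sle; rewrite -[leRHS]mul1r -s1 mulr_suml.
  by apply: ler_sum => v _; apply: ler_wpM2l.
have h1 := avg _ _ p3 S1le; have h2 := avg _ _ p2 S2le.
have d0 := dens_ge0 a p1 p2; have d1 := dens_le1 a p1 p2.
have eps0 : 0 <= eps.
  by apply: le_trans (@reg12 a (fun=> 1) (fun=> 1) _ _) => // ?; apply: one01.
have := ler_wpM2l d0 h2.
have : dens a nu1 nu2 * eps <= eps by rewrite ler_piMl.
by lra.
Qed.

End Counting.

(** * Energy increment by tilting measures *)

Section Energy.
Variable K : nat.
Implicit Types (mu : 'I_K -> V -> R) (delta : V -> R) (i j k l : 'I_K).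

Definition energy mu : R :=
  \sum_(i < K) \sum_(j < K | (i < j)%N) \sum_a dens a (mu i) (mu j) ^+ 2.

(* Replacing mu_i by mu_i + delta and mu_i - delta, with |delta| <= mu_i, plays the
   role of splitting a vertex class in two, but without creating small classes. *)
Definition tilt mu i delta : 'I_K -> V -> R :=
  fun k u => mu k u + (k == i)%:R * delta u.

Lemma dens_tilt mu i delta a k l : k != l ->
  dens a (tilt mu i delta k) (tilt mu i delta l) =
  dens a (mu k) (mu l) + (k == i)%:R * dens a delta (mu l)
  + (l == i)%:R * dens a (mu k) delta.
Proof.
move=> kl; rewrite /dens !mulr_sumr -!big_split /=; apply: eq_bigr => u _.
rewrite !mulr_sumr -!big_split /=; apply: eq_bigr => v _; rewrite /tilt.
have [ki|] := eqVneq k i; have [li|] := eqVneq l i; rewrite /=; try by move=> *; ring.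
by rewrite ki li eqxx in kl.
Qed.

Lemma dens_opp a delta nu : dens a (fun u => - delta u) nu = - dens a delta nu.
Proof.
by rewrite /dens -sumrN; apply: eq_bigr => u _; rewrite -sumrN; apply: eq_bigr => v _; ring.
Qed.

Lemma dens_oppr a delta nu : dens a nu (fun u => - delta u) = - dens a nu delta.
Proof.
by rewrite /dens -sumrN; apply: eq_bigr => u _; rewrite -sumrN; apply: eq_bigr => v _; ring.
Qed.

Lemma energy_ge0 mu : 0 <= energy mu.
Proof. by do 3!apply: sumr_ge0 => ? _; rewrite sqr_ge0. Qed.

Lemma energy_le mu : (forall k, is_proba (mu k)) -> energy mu <= (K * K * #|C|)%:R.
Proof.
move=> pmu.
have -> : (K * K * #|C|)%:R = \sum_(i < K) \sum_(j < K) \sum_(a : C) 1 :> R.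
  by rewrite !sumr_const !card_ord -!mulrnA mulnC mulnA.
apply: ler_sum => i _; rewrite big_mkcond; apply: ler_sum => j _.
case: ifP => _; last by apply: sumr_ge0.
by apply: ler_sum => a _; rewrite expr_le1 ?dens_ge0 ?dens_le1.
Qed.

(** For [k < l] at most one argument is tilted, so every density is affine in [delta]. Averaging
    over both signs cancels the linear terms and leaves the squares, of which one is kept. *)
Lemma energy_tilt mu i delta k l a : (k < l)%N ->
  energy mu + ((k == i)%:R * dens a delta (mu l) + (l == i)%:R * dens a (mu k) delta) ^+ 2
  <= (energy (tilt mu i delta) + energy (tilt mu i (fun u => - delta u))) / 2.
Proof.
pose X k l a := (k == i)%:R * dens a delta (mu l) + (l == i)%:R * dens a (mu k) delta.
rewrite -/(X k l a) => kl.
have -> : (energy (tilt mu i delta) + energy (tilt mu i (fun u => - delta u))) / 2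
  = energy mu + \sum_(k < K) \sum_(l < K | (k < l)%N) \sum_a X k l a ^+ 2.
  rewrite /energy -!big_split mulr_suml /=; apply: eq_bigr => k' _.
  rewrite -!big_split mulr_suml /=; apply: eq_bigr => l' kl'.
  rewrite -!big_split mulr_suml /=; apply: eq_bigr => a' _.
  by rewrite !dens_tilt ?neq_ltn ?kl' //= dens_opp dens_oppr /X; field.
rewrite lerD2l (bigD1 k) //= (bigD1 l) //= (bigD1 a) //= -!addrA lerDl.
by rewrite !addr_ge0 //; do ![apply: sumr_ge0 => ? _]; rewrite sqr_ge0.
Qed.

Lemma tilt_proba mu i delta :
  (forall k, is_proba (mu k)) -> \sum_u delta u = 0 ->
  (forall u, `|delta u| <= mu i u) -> forall k, is_proba (tilt mu i delta k).
Proof.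
move=> pmu s0 le k; split=> [u|].
  rewrite /tilt; have [->|_] := eqVneq k i; last by rewrite mul0r addr0 (pmu k).1.
  by have := le u; rewrite ler_norml mul1r => /andP[? _]; lra.
by rewrite big_split /= -mulr_sumr s0 mulr0 addr0 (pmu k).2.
Qed.

Lemma tilt_le mu i delta k u : (forall k u, 0 <= mu k u) ->
  (forall u, `|delta u| <= mu i u) ->
  tilt mu i delta k u <= (1 + (k == i)%:R) * mu k u.
Proof.
move=> mu0 le; rewrite /tilt mulrDl mul1r lerD2l.
have [->|_] := eqVneq k i; last by rewrite !mul0r.
by rewrite !mul1r (le_trans (ler_norm _)).
Qed.

Section Increment.
Variables (mu : 'I_K -> V -> R) (i j : 'I_K) (a : C) (F G : V -> R).
Hypotheses (pmu : forall k, is_proba (mu k)) (ij : (i < j)%N).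
Hypotheses (F01 : forall u, 0 <= F u <= 1) (G01 : forall v, 0 <= G v <= 1).

Let mF := \sum_u mu i u * F u.
Let mG := \sum_v mu j v * G v.
Let deltaF u := mu i u * (F u - mF).
Let deltaG v := mu j v * (G v - mG).

Lemma mean01 k (E : V -> R) : (forall u, 0 <= E u <= 1) ->
  0 <= \sum_u mu k u * E u <= 1.
Proof.
move=> E01; have [p s1] := pmu k; apply/andP; split.
  by apply: sumr_ge0 => u _; have /andP[? ?] := E01 u; rewrite mulr_ge0.
rewrite -[leRHS]s1; apply: ler_sum => u _; have /andP[? ?] := E01 u.
by rewrite ler_piMr.
Qed.

Lemma centered_sum k (E : V -> R) : \sum_u mu k u * (E u - \sum_v mu k v * E v) = 0.
Proof.
under eq_bigr do rewrite mulrBr.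
by rewrite sumrB -mulr_suml (pmu k).2 mul1r subrr.
Qed.

Lemma centered_le k (E : V -> R) u : (forall u, 0 <= E u <= 1) ->
  `|mu k u * (E u - \sum_v mu k v * E v)| <= mu k u.
Proof.
move=> E01; have := mean01 k E01 => /andP[? ?]; have /andP[? ?] := E01 u.
rewrite normrM ger0_norm ?(pmu k).1 // ler_piMr ?(pmu k).1 //.
rewrite ler_norml; apply/andP; split; lra.
Qed.

(** Write [mu i * F] as [deltaF + mF * mu i], likewise for [G], and expand bilinearly. The product
    of the two mean parts cancels against the subtracted density. *)
Lemma discrepancy_split :
  \sum_u \sum_v mu i u * mu j v * (F u * G v * ((phi u v == a)%:R - dens a (mu i) (mu j)))
  = dens a deltaF deltaG + mG * dens a deltaF (mu j) + mF * dens a (mu i) deltaG.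
Proof.
set d := dens a (mu i) (mu j).
pose S (f : V -> V -> R) := \sum_u \sum_v mu i u * mu j v * f u v.
have SD f g : S (fun u v => f u v + g u v) = S f + S g.
  rewrite /S -big_split; apply: eq_bigr => u _; rewrite -big_split.
  by apply: eq_bigr => v _ /=; ring.
have SZ (c : R) f : S (fun u v => c * f u v) = c * S f.
  rewrite /S mulr_sumr; apply: eq_bigr => u _; rewrite mulr_sumr.
  by apply: eq_bigr => v _ /=; ring.
have eS f g : (forall u v, f u v = g u v) -> S f = S g.
  by move=> fg; do 2!apply: eq_bigr => ? _; rewrite fg.
pose e u v : R := (phi u v == a)%:R.
pose P := S (fun u v => F u * G v * e u v).
pose Q1 := S (fun u v => F u * e u v).
pose Q2 := S (fun u v => G v * e u v).
have Sd : S e = d by [].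
have -> : \sum_u \sum_v mu i u * mu j v * (F u * G v * ((phi u v == a)%:R - d))
    = P - d * (mF * mG).
  have -> : mF * mG = S (fun u v => F u * G v).
    rewrite /S /mF mulr_suml; apply: eq_bigr => u _; rewrite mulr_sumr.
    by apply: eq_bigr => v _; ring.
  rewrite -mulNr -SZ -SD; do 2!apply: eq_bigr => ? _; rewrite /e; ring.
have -> : dens a deltaF (mu j) = Q1 - mF * d.
  rewrite -Sd -mulNr -SZ -SD; do 2!apply: eq_bigr => ? _; rewrite /deltaF /e; ring.
have -> : dens a (mu i) deltaG = Q2 - mG * d.
  rewrite -Sd -mulNr -SZ -SD; do 2!apply: eq_bigr => ? _; rewrite /deltaG /e; ring.
have -> : dens a deltaF deltaG = P - mG * Q1 - mF * Q2 + mF * mG * d.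
  rewrite -Sd -!mulNr -!SZ -!SD; do 2!apply: eq_bigr => ? _.
  rewrite /deltaF /deltaG /e; ring.
ring.
Qed.

(* By the parallelogram law, the four measures obtained by tilting mu_i and mu_j
   have average energy at least that of mu plus the squares of the three terms
   of discrepancy_split without their coefficients. *)
Lemma energy_increment eps : 0 <= eps ->
  eps < `|\sum_u \sum_v mu i u * mu j v *
          (F u * G v * ((phi u v == a)%:R - dens a (mu i) (mu j)))| ->
  exists mu', [/\ forall k, is_proba (mu' k),
    forall k u, mu' k u <= 2 * mu k u & energy mu + eps ^+ 2 / 3 <= energy mu'].
Proof.
move=> eps0; rewrite discrepancy_split.
set b1 := dens a deltaF (mu j); set b2 := dens a (mu i) deltaG.
set b3 := dens a deltaF deltaG => ltB.
have neq_ij : i != j by rewrite neq_ltn ij.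
have /andP[F0 F1] := mean01 i F01; have /andP[G0 G1] := mean01 j G01.
(* The [3] comes from Cauchy-Schwarz for three terms; the coefficients [mF] and [mG] are at most
   [1]. *)
have sq : eps ^+ 2 / 3 <= b1 ^+ 2 + b2 ^+ 2 + b3 ^+ 2.
  have : eps < `|b3| + `|b1| + `|b2|.
    apply: lt_le_trans ltB _; rewrite (le_trans (ler_normD _ _)) // lerD //.
      rewrite (le_trans (ler_normD _ _)) // lerD // normrM ler_piMl //.
      by rewrite ger0_norm.
    by rewrite normrM ler_piMl // ger0_norm.
  rewrite -(real_normK (num_real b1)) -(real_normK (num_real b2)) -(real_normK (num_real b3)).
  move: (normr_ge0 b1) (normr_ge0 b2) (normr_ge0 b3).
  move: `|b1| `|b2| `|b3| => x y z x0 y0 z0 lt.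
  have h : eps ^+ 2 <= (z + x + y) ^+ 2 by rewrite lerXn2r ?nnegrE //; lra.
  have := sqr_ge0 (x - y); have := sqr_ge0 (y - z); have := sqr_ge0 (x - z).
  by nra.
pose dF (s : bool) u := if s then deltaF u else - deltaF u.
pose dG (t : bool) u := if t then deltaG u else - deltaG u.
pose mu1 s := tilt mu i (dF s).
pose mu2 s t := tilt (mu1 s) j (dG t).
have sdF s : \sum_u dF s u = 0.
  by case: s; rewrite /dF /= ?sumrN centered_sum ?oppr0.
have sdG s : \sum_u dG s u = 0.
  by case: s; rewrite /dG /= ?sumrN centered_sum ?oppr0.
have ldF s u : `|dF s u| <= mu i u.
  by case: s; rewrite /dF ?normrN centered_le.
have mu1j s u : mu1 s j u = mu j u.
  by rewrite /mu1 /tilt eq_sym (negbTE neq_ij) mul0r addr0.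
have ldG s t u : `|dG t u| <= mu1 s j u.
  by rewrite mu1j; case: t; rewrite /dG ?normrN centered_le.
have p1 s k : is_proba (mu1 s k) by apply: tilt_proba.
have p2 s t k : is_proba (mu2 s t k) by apply: tilt_proba.
(* As [i != j], no measure is tilted twice, so the factor is [2] and not [4]. *)
have le2 s t k u : mu2 s t k u <= 2 * mu k u.
  apply: le_trans (tilt_le _ _ _ _) _ => //; first by move=> ? ?; apply: (p1 _ _).1.
  have := @tilt_le mu i (dF s) k u (fun k u => (pmu k).1 u) (ldF s).
  rewrite -/(mu1 s); have [->|_] := eqVneq k j.
    by rewrite eq_sym (negbTE neq_ij) addr0 mul1r => ?; rewrite -[1 + 1]/(2) ler_wpM2l.
  rewrite addr0 mul1r => /le_trans; apply; rewrite ler_wpM2r ?(pmu k).1 //.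
  by case: (k == i); rewrite /=; lra.
have E1 : energy mu + b1 ^+ 2 <= (energy (mu1 true) + energy (mu1 false)) / 2.
  have := @energy_tilt mu i deltaF i j a ij.
  by rewrite eqxx eq_sym (negbTE neq_ij) mul1r mul0r addr0.
have E2 s : energy (mu1 s) + dens a (mu1 s i) deltaG ^+ 2 <=
    (energy (mu2 s true) + energy (mu2 s false)) / 2.
  have := @energy_tilt (mu1 s) j deltaG i j a ij.
  by rewrite eqxx (negbTE neq_ij) mul1r mul0r add0r.
(* The first tilt moves [b2] by plus or minus [b3]; averaging the squares over both signs gives
   [b2 ^+ 2 + b3 ^+ 2]. *)
have D2 s : dens a (mu1 s i) deltaG = b2 + (if s then b3 else - b3).
  have -> : dens a (mu1 s i) deltaG = b2 + dens a (dF s) deltaG.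
    rewrite /b2 /dens -big_split; apply: eq_bigr => u _; rewrite -big_split.
    by apply: eq_bigr => v _; rewrite /mu1 /tilt eqxx /=; ring.
  by case: s => //; rewrite -dens_opp.
have := E2 true; have := E2 false; rewrite !D2 => Ef Et.
have sqD : (b2 + b3) ^+ 2 + (b2 - b3) ^+ 2 = 2 * b2 ^+ 2 + 2 * b3 ^+ 2 by ring.
have [s [t est]] : exists s t, energy mu + eps ^+ 2 / 3 <= energy (mu2 s t).
  case: (leP (energy mu + eps ^+ 2 / 3) (energy (mu2 true true))) => [?|l1].
    by exists true, true.
  case: (leP (energy mu + eps ^+ 2 / 3) (energy (mu2 true false))) => [?|l2].
    by exists true, false.
  case: (leP (energy mu + eps ^+ 2 / 3) (energy (mu2 false true))) => [?|l3].
    by exists false, true.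
  exists false, false; lra.
by exists (mu2 s t).
Qed.

End Increment.

(** Induction on the number of increments: as long as some pair is irregular, one more step gains
    [eps ^+ 2 / 3] and at most doubles the measures. *)
Lemma regularity eps m mu : 0 <= eps -> (forall k, is_proba (mu k)) ->
  exists mu', [/\ forall k, is_proba (mu' k),
    forall k u, mu' k u <= 2 ^+ m * mu k u &
    (forall i j, (i < j)%N -> regular eps (mu' i) (mu' j)) \/
    m%:R * (eps ^+ 2 / 3) <= energy mu'].
Proof.
move=> eps0 pmu; elim: m => [|m [mu' [pmu' le' IH]]].
  exists mu; split=> //; first by move=> k u; rewrite expr0 mul1r.
  by right; rewrite mul0r energy_ge0.
have pow2 x : 0 <= x -> 2 ^+ m * x <= 2 ^+ m.+1 * x.
  by move=> x0; rewrite exprS -mulrA ler_peMl ?ler1n // mulr_ge0 // exprn_ge0.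
have [reg|] := pselect (forall i j, (i < j)%N -> regular eps (mu' i) (mu' j)).
  exists mu'; split=> //; last by left.
  by move=> k u; apply: le_trans (le' k u) _; rewrite pow2 ?(pmu k).1.
case: IH => [//|IH] /existsNP[i /existsNP[j /not_implyP[ij]]].
move=> /existsNP[a /existsNP[F /existsNP[G]]].
move=> /not_implyP[F01 /not_implyP[G01 /negP]]; rewrite -ltNge => ltB.
have [mu2 [p2 le2 E2]] := energy_increment pmu' ij F01 G01 eps0 ltB.
exists mu2; split=> //.
  move=> k u; apply: le_trans (le2 k u) _; rewrite exprS -mulrA ler_wpM2l //.
right; apply: le_trans E2; rewrite -[m.+1]addn1 natrD mulrDl mul1r; lra.
Qed.

(** Here [m] increments would exceed the largest possible energy, so regularity must occur. *)
Lemma exists_regular eps mu m : 0 < eps -> (forall k, is_proba (mu k)) ->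
  (K * K * #|C|)%:R < m%:R * (eps ^+ 2 / 3) ->
  exists mu', [/\ forall k, is_proba (mu' k),
    forall k u, mu' k u <= 2 ^+ m * mu k u &
    forall i j, (i < j)%N -> regular eps (mu' i) (mu' j)].
Proof.
move=> eps0 pmu ltm; have [mu' [p' le' [reg|]]] := regularity m (ltW eps0) pmu.
  by exists mu'.
by move=> /(lt_le_trans ltm); rewrite ltNge energy_le.
Qed.

End Energy.
End Regularity.

(** * Ramsey *)

Section Ramsey.
Variables (Q : finType) (q0 : Q).

Lemma pigeonhole (T : Type) (f : T -> Q) (K : nat) (s : seq T) :
  (K * #|Q| <= size s)%N -> exists q, (K <= count (fun y => f y == q) s)%N.
Proof.
move=> le; apply: contrapT => /forallNP lt.
have Q0 : (0 < #|Q|)%N by apply/card_gt0P; exists q0.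
have sz : size s = (\sum_q count (fun y => f y == q) s)%N.
  under eq_bigr do rewrite -sum1_count big_mkcond.
  rewrite exchange_big -sum1_size /=; apply: eq_bigr => y _.
  rewrite (bigD1 (f y)) //= eqxx big1 // => q.
  by rewrite eq_sym => /negbTE ->.
have K0 : (0 < K)%N.
  by rewrite lt0n; apply/eqP => K0; apply: (lt q0); rewrite K0.
have : (size s <= \sum_(q : Q) K.-1)%N.
  by rewrite sz; apply: leq_sum => q _; have := lt q; lia.
rewrite sum_nat_const leqNgt => /negP; apply; apply: leq_trans le.
by rewrite mulnC ltn_pmul2r // ltn_predL.
Qed.

(** Every selected element carries the common colour of its pairs with all later ones: keep the
    head, restrict the tail to a majority colour seen from it, and recurse. *)
Lemma ramsey_prehomogeneous (N : nat) : exists K : nat,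
  forall (T : eqType) (c : T -> T -> Q) (s : seq T), (K <= size s)%N ->
  exists l : seq (T * Q), [/\ size l = N, subseq (map fst l) s &
    pairwise (fun p p' => c p.1 p'.1 == p.2) l].
Proof.
elim: N => [|N [K IH]].
  by exists 0%N => T c s _; exists [::]; rewrite sub0seq.
exists (K * #|Q|).+1 => T c [//|x s] /= /pigeonhole-/(_ (c x))[q].
rewrite -size_filter => /(IH _ c)[l [szl sub pw]].
exists ((x, q) :: l); split; first by rewrite /= szl.
  by rewrite /= eqxx (subseq_trans sub) // filter_subseq.
rewrite /= pw andbT; apply/allP => p lp /=.
have := mem_subseq sub (map_f fst lp).
by rewrite mem_filter => /andP[].
Qed.

(** Pigeonhole on the colours attached to a prehomogeneous list of length [t * #|Q|]. *)
Lemma ramsey (t : nat) : exists K : nat,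
  forall (T : eqType) (c : T -> T -> Q) (s : seq T), (K <= size s)%N ->
  exists q s', [/\ size s' = t, subseq s' s & pairwise (fun x y => c x y == q) s'].
Proof.
have [K HK] := ramsey_prehomogeneous (t * #|Q|); exists K => T c s /(HK _ c).
move=> [l [szl sub pw]].
have [|q le] := @pigeonhole _ snd t l; first by rewrite szl.
pose l' := take t [seq p <- l | p.2 == q].
have sub' : subseq l' l.
  exact: subseq_trans (take_subseq _ _) (filter_subseq _ _).
exists q, (map fst l'); split.
- by rewrite size_map size_takel // size_filter.
- exact: subseq_trans (map_subseq _ sub') sub.
rewrite pairwise_map; have := subseq_pairwise sub' pw.
apply: sub_in_pairwise (allss l') => p p' lp _ /= /eqP ->.
by move: lp => /mem_take; rewrite mem_filter => /andP[].
Qed.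

End Ramsey.

(** Regularize first, then apply Ramsey with the vector of rounded densities as the colour of a
    pair. The numbers [K] and [M] precede [V], so that [eta] can later be chosen from them. *)
Lemma regular_family (R : realType) (C : finType) (eps : R) (t : nat) : 0 < eps ->
  exists K M : nat, forall (V : finType) (phi : V -> V -> C) (mu : 'I_K -> V -> R),
  (forall k, is_proba (mu k)) ->
  exists (g : 'I_t -> 'I_K) (nu : 'I_t -> V -> R),
  [/\ forall i j : 'I_t, (i < j)%N -> (g i < g j)%N,
      forall i, is_proba (nu i),
      forall i u, nu i u <= 2 ^+ M * mu (g i) u,
      forall i j : 'I_t, (i < j)%N -> regular phi eps (nu i) (nu j) &
      forall i j i' j' : 'I_t, (i < j)%N -> (i' < j')%N -> forall a,
        `|dens phi a (nu i) (nu j) - dens phi a (nu i') (nu j')| <= eps].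
Proof.
move=> eps0.
(* Densities are rounded down to multiples of [1 / L], and [1 / L <= eps]. The rounded values are
   [0] to [L], hence the type ['I_L.+1]. *)
pose L := (Num.truncn eps^-1).+1.
have L0 : 0 < L%:R :> R by rewrite ltr0n.
have Leps : 1 <= L%:R * eps.
  by rewrite -ler_pdivrMr // mul1r ltW // truncnS_gt.
have [K HK] := ramsey [ffun _ : C => ord0 : 'I_L.+1] t.
have [M ltM] : exists M : nat, (K * K * #|C|)%:R < M%:R * (eps ^+ 2 / 3).
  exists (Num.truncn ((K * K * #|C|)%:R / (eps ^+ 2 / 3))).+1.
  by rewrite -ltr_pdivrMr ?truncnS_gt // divr_gt0 ?exprn_gt0.
exists K, M => V phi mu pmu.
have [mu' [pmu' le' reg]] := exists_regular phi eps0 pmu ltM.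
pose c (i j : 'I_K) : {ffun C -> 'I_L.+1} :=
  [ffun a => inord (Num.truncn (L%:R * dens phi a (mu' i) (mu' j)))].
have [|q [s [szs sub pw]]] := HK _ c (enum 'I_K); first by rewrite -cardE card_ord.
have lts : pairwise (fun i j : 'I_K => (i < j)%N) s.
  apply: subseq_pairwise sub _.
  rewrite -(pairwise_map (fun i : 'I_K => nat_of_ord i) ltn) val_enum_ord.
  rewrite -sorted_pairwise; [exact: iota_ltn_sorted | exact: ltn_trans].
pose tup := Tuple (introT eqP szs).
pose g i := tnth tup i.
have nth_g (i j : 'I_t) (ij : (i < j)%N) (r : rel 'I_K) : pairwise r s -> r (g i) (g j).
  have x0 := g i; move/(pairwiseP x0)/(_ i j); rewrite !inE szs !ltn_ord.
  by move/(_ isT isT ij); rewrite /g (tnth_nth x0 tup i) (tnth_nth x0 tup j).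
exists g, (fun i => mu' (g i)); split=> //.
- by move=> i j ij; apply: (nth_g _ _ ij (fun i j => (i < j)%N) lts).
- by move=> i j ij; apply: reg; apply: (nth_g _ _ ij (fun i j => (i < j)%N) lts).
move=> i j i' j' ij ij' a.
have /eqP ci := nth_g _ _ ij _ pw; have /eqP cj := nth_g _ _ ij' _ pw.
have : c (g i) (g j) a = c (g i') (g j') a by rewrite ci cj.
have := dens_ge0 phi a (pmu' (g i)) (pmu' (g j)).
have := dens_le1 phi a (pmu' (g i)) (pmu' (g j)).
have := dens_ge0 phi a (pmu' (g i')) (pmu' (g j')).
have := dens_le1 phi a (pmu' (g i')) (pmu' (g j')).
rewrite /c !ffunE; move: (dens _ _ _ _) (dens _ _ _ _) => x y y1 y0 x1 x0.
have tr z : 0 <= z -> z <= 1 -> (Num.truncn (L%:R * z) < L.+1)%N.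
  move=> z0 z1; rewrite truncn_lt_nat ?mulr_ge0 ?(ltW L0) // -natr1 ltr_pwDr //.
  by rewrite ler_piMr // ltW.
move=> /(congr1 val); rewrite /= !inordK ?tr // => eqt.
have /andP[a1 a2] := truncn_itv (mulr_ge0 (ltW L0) x0).
have /andP[b1 b2] := truncn_itv (mulr_ge0 (ltW L0) y0).
rewrite eqt -natr1 in a1 a2; rewrite -natr1 in b2.
have e1 : L%:R * (x - y) <= 1 by rewrite mulrBr; lra.
have e2 : L%:R * (y - x) <= 1 by rewrite mulrBr; lra.
have e3 : `|x - y| * L%:R <= 1.
  by rewrite mulrC; case: (lerP 0 (x - y)) => [/ger0_norm|/ltr0_norm] ->; rewrite ?opprB.
by rewrite -(ler_pM2r L0) (le_trans e3) // mulrC.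
Qed.

(** * Upper bound for the density of a palette *)

Definition palette_density (R : realType) (C : finType) (A : C -> C -> C -> bool)
    (x : C -> R) : R :=
  \sum_a \sum_b \sum_(c | A a b c) x a * x b * x c.

(** Take the uniform measures on consecutive blocks of [S] vertices in the order of [r]. *)
Lemma interval_probas (R : realType) (V : finType) (r : V -> nat) (K S : nat) :
  injective r -> (0 < S)%N -> (K * S <= #|V|)%N ->
  exists mu : 'I_K -> V -> R, [/\ forall k, is_proba (mu k),
    forall k v, mu k v <= S%:R^-1 &
    forall (k l : 'I_K) u v, mu k u != 0 -> mu l v != 0 -> (k < l)%N -> (r u < r v)%N].
Proof.
move=> injr S0 KS.
(* The number of predecessors turns the arbitrary ranks into positions [0, ..., #|V| - 1]. *)
pose pos v := #|[set u | (r u < r v)%N]%SET|.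
have pos_mono u v : (r u < r v)%N -> (pos u < pos v)%N.
  move=> uv; apply: proper_card; apply/properP; split.
    by apply/fintype.subsetP => x; rewrite !inE => /ltn_trans; apply.
  by exists u; rewrite !inE ?ltnn.
have pos_lt v : (pos v < #|V|)%N.
  rewrite -cardsT; apply: proper_card; apply/properP; split; first exact: finset.subsetT.
  by exists v; rewrite !inE ?ltnn.
pose f v := Ordinal (pos_lt v).
have injf : injective f.
  move=> u v /(congr1 val) /= puv; apply: injr.
  by case: (ltngtP (r u) (r v)) => // /pos_mono; rewrite puv ltnn.
have bijf : bijective f by apply: inj_card_bij => //; rewrite card_ord.
exists (fun (k : 'I_K) v => (pos v %/ S == k :> nat)%N%:R / S%:R); split.
- move=> k; split=> [u|]; first by rewrite divr_ge0.
  rewrite -mulr_suml.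
  have -> : \sum_u (pos u %/ S == k :> nat)%N%:R = \sum_(i < #|V|) (i %/ S == k :> nat)%N%:R :> R.
    by rewrite (reindex f) //; apply: onW_bij.
  have kS : (k * S + S <= #|V|)%N.
    by apply: leq_trans KS; rewrite addnC -mulSn leq_mul2r ltn_ord orbT.
  rewrite -(big_mkord xpredT (fun i => (i %/ S == k :> nat)%N%:R : R)).
  rewrite (@big_cat_nat _ _ _ (k * S)) //=; last exact: leq_trans (leq_addr _ _) kS.
  rewrite (@big_cat_nat _ _ _ (k * S + S) (k * S)) ?leq_addr //=.
  rewrite big_nat_cond big1 ?add0r; last first.
    move=> i /andP[/andP[_ lt] _]; move: lt; rewrite -ltn_divLR // => lt.
    by rewrite (ltn_eqF lt).
  rewrite [X in _ + X]big_nat_cond [X in _ + X]big1 ?addr0; last first.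
    move=> i /andP[/andP[ge _] _]; move: ge; rewrite addnC -mulSn -leq_divRL // => ge.
    by rewrite (gtn_eqF ge).
  rewrite (@eq_big_nat _ _ _ _ _ _ (fun=> 1)); last first.
    move=> i /andP[ge lt]; suff -> : (i %/ S)%N = k by rewrite eqxx.
    by apply/eqP; rewrite eqn_leq -ltnS ltn_divLR // leq_divRL // ge mulSn addnC lt.
  by rewrite sumr_const_nat addKn divff // pnatr_eq0 -lt0n.
- move=> k v; rewrite ler_piMl ?invr_ge0 //; by case: eqP.
move=> k l u v; rewrite !mulf_eq0 !negb_or !pnatr_eq0 !eqb0 !negbK.
move=> /andP[/eqP pu _] /andP[/eqP pv _]; rewrite -pu -pv => lt.
case: (ltngtP (r u) (r v)) => // [/pos_mono/ltnW le|/injr uv].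
  by have := leq_trans lt (leq_div2r S le); rewrite ltnn.
by rewrite uv ltnn in lt.
Qed.

Lemma prod3_close (R : realType) (x y z x' y' z' eps : R) :
  0 <= x <= 1 -> 0 <= y <= 1 -> 0 <= z <= 1 ->
  0 <= x' <= 1 -> 0 <= y' <= 1 -> 0 <= z' <= 1 ->
  `|x - x'| <= eps -> `|y - y'| <= eps -> `|z - z'| <= eps ->
  x * y * z <= x' * y' * z' + 3 * eps.
Proof.
move=> /andP[x0 x1] /andP[y0 y1] /andP[z0 z1] /andP[a0 a1] /andP[b0 b1] /andP[c0 c1].
move=> h1 h2 h3; have e0 := le_trans (normr_ge0 _) h1.
have small a p : `|a| <= eps -> 0 <= p -> p <= 1 -> a * p <= eps.
  move=> /(le_trans (ler_norm _)) ae p0 p1.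
  by apply: le_trans (ler_wpM2r p0 ae) _; rewrite ler_piMr.
have -> : x * y * z = x' * y' * z' + ((x - x') * (y * z) + (y - y') * (x' * z)
                      + (z - z') * (x' * y')) by ring.
have k1 := small _ (y * z) h1 (mulr_ge0 y0 z0) (mulr_ile1 y0 z0 y1 z1).
have k2 := small _ (x' * z) h2 (mulr_ge0 a0 z0) (mulr_ile1 a0 z0 a1 z1).
have k3 := small _ (x' * y') h3 (mulr_ge0 a0 b0) (mulr_ile1 a0 b0 a1 b1).
lra.
Qed.

(** The gain from transversal triples, cubic in [t], must outweigh the quadratic loss from
    degenerate ones. *)
Lemma binomial3_large (R : realType) (e : R) : 0 < e ->
  exists2 t : nat, (1 < t)%N & 2 * t%:R ^+ 2 + 1 < 'C(t, 3)%:R * (e / 2).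
Proof.
(* [228 = 12 * 19]: the right-hand side is [(s + 2) (s + 1) s e / 12], which then exceeds
   [19 (s + 2) (s + 1)], and this dominates the left-hand side. *)
move=> e0; pose s := (Num.truncn (228 / e)).+1; exists s.+2 => //.
have lts : 228 < s%:R * e by rewrite -ltr_pdivrMr // truncnS_gt.
have s1 : 1 <= s%:R :> R by rewrite ler1n.
have binE : 'C(s.+2, 3)%:R * 6 = (s%:R + 2) * (s%:R + 1) * s%:R :> R.
  have : ('C(s.+2, 3) * 6 = s.+2 * s.+1 * s)%N.
    by have := bin_ffact s.+2 3; rewrite !ffactnS ffactn0 /= muln1 mulnA.
  move=> /(congr1 (fun n => n%:R : R)); rewrite natrM => ->.
  by rewrite !natrM -[s.+2]addn2 -[s.+1]addn1 !natrD.
have -> : 'C(s.+2, 3)%:R = (s%:R + 2) * (s%:R + 1) * s%:R / 6 :> R by rewrite -binE; field.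
rewrite -[s.+2]addn2 natrD; move: (s%:R : R) lts s1 => x xe x1.
have h : 228 * ((x + 2) * (x + 1)) < x * e * ((x + 2) * (x + 1)).
  by rewrite ltr_pM2r // mulr_gt0 //; lra.
have -> : (x + 2) * (x + 1) * x / 6 * (e / 2) = x * e * ((x + 2) * (x + 1)) / 12 by field.
nra.
Qed.

Lemma sum_patterns (R : realType) (C : finType) (A : C -> C -> C -> bool) (z : R) a b c :
  \sum_a' \sum_b' \sum_(c' | A a' b' c')
    z * ((a == a')%:R * (b == b')%:R * (c == c')%:R) = z * (A a b c)%:R.
Proof.
rewrite (bigD1 a) //= [X in _ + X]big1 ?addr0; last first.
  move=> a'; rewrite eq_sym => /negbTE ->.
  by do 2!apply: big1 => ? _; rewrite !mul0r mulr0.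
rewrite (bigD1 b) //= [X in _ + X]big1 ?addr0; last first.
  move=> b'; rewrite eq_sym => /negbTE ->.
  by apply: big1 => ? _; rewrite mulr0 mul0r mulr0.
rewrite !eqxx big_mkcond /= (bigD1 c) //= [X in _ + X]big1 ?addr0.
  by rewrite eqxx; case: ifP => _; rewrite !(mulr0, mulr1).
by move=> c'; rewrite eq_sym => /negbTE ->; rewrite !mulr0 if_same.
Qed.

Section UpperBound.
Variables (R : realType) (C : finType) (A : C -> C -> C -> bool) (lam d : R).
Hypothesis density_le : forall x : C -> R,
  (forall a, 0 <= x a) -> \sum_a x a = 1 -> palette_density A x <= lam.

(** Each of at most [#|C| ^ 3] patterns costs [2 * eps] for counting and [3 * eps] for replacing its
    three densities by [x]. *)
Lemma transversal_count (V : finType) (phi : V -> V -> C) (nu1 nu2 nu3 : V -> R)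
    (x : C -> R) (eps : R) :
  is_proba nu1 -> is_proba nu2 -> is_proba nu3 ->
  regular phi eps nu1 nu2 -> regular phi eps nu1 nu3 ->
  (forall a, 0 <= x a) -> \sum_a x a = 1 ->
  (forall a, `|dens phi a nu1 nu2 - x a| <= eps) ->
  (forall a, `|dens phi a nu1 nu3 - x a| <= eps) ->
  (forall a, `|dens phi a nu2 nu3 - x a| <= eps) ->
  \sum_u \sum_v \sum_w nu1 u * nu2 v * nu3 w *
     (A (phi u v) (phi u w) (phi v w))%:R <= lam + 5 * eps * (#|C| ^ 3)%:R.
Proof.
move=> p1 p2 p3 r12 r13 x0 sx d12 d13 d23.
have x01 a : 0 <= x a <= 1.
  by rewrite x0 -sx (bigD1 a) //= lerDl sumr_ge0.
have dens01 a (nu nu' : V -> R) : is_proba nu -> is_proba nu' -> 0 <= dens phi a nu nu' <= 1.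
  by move=> ? ?; rewrite dens_ge0 // dens_le1.
have eps0 : 0 <= eps.
  case: (pickP (mem C)) => [a _|noC]; first exact: le_trans (d12 a).
  by move: sx; rewrite big_pred0 // => /eqP; rewrite eq_sym oner_eq0.
pose tri a b c := \sum_u \sum_v \sum_w nu1 u * nu2 v * nu3 w *
     ((phi u v == a)%:R * (phi u w == b)%:R * (phi v w == c)%:R).
have -> : \sum_u \sum_v \sum_w nu1 u * nu2 v * nu3 w *
     (A (phi u v) (phi u w) (phi v w))%:R = \sum_a \sum_b \sum_(c | A a b c) tri a b c.
  under [RHS]eq_bigr do under eq_bigr do rewrite exchange_big /=.
  under [RHS]eq_bigr do rewrite exchange_big /=.
  rewrite [RHS]exchange_big /=; apply: eq_bigr => u _.
  under [RHS]eq_bigr do under eq_bigr do rewrite exchange_big /=.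
  under [RHS]eq_bigr do rewrite exchange_big /=.
  rewrite [RHS]exchange_big /=; apply: eq_bigr => v _.
  under [RHS]eq_bigr do under eq_bigr do rewrite exchange_big /=.
  under [RHS]eq_bigr do rewrite exchange_big /=.
  rewrite [RHS]exchange_big /=; apply: eq_bigr => w _.
  by rewrite sum_patterns.
have le3 a b c : tri a b c <= x a * x b * x c + 5 * eps.
  apply: le_trans (triangle_count p1 p2 p3 r12 r13 a b c) _.
  have := prod3_close (dens01 a _ _ p1 p2) (dens01 b _ _ p1 p3) (dens01 c _ _ p2 p3)
    (x01 a) (x01 b) (x01 c) (d12 a) (d13 b) (d23 c).
  by lra.
apply: (@le_trans _ _ (palette_density A x + 5 * eps * (#|C| ^ 3)%:R)); last first.
  by rewrite lerD2r density_le.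
have -> : 5 * eps * (#|C| ^ 3)%:R = \sum_(a : C) \sum_(b : C) \sum_(c : C) 5 * eps.
  by rewrite !sumr_const -!mulrnA mulr_natr expnS expnS expn1 mulnA.
rewrite /palette_density -big_split; apply: ler_sum => a _.
rewrite -big_split; apply: ler_sum => b _ /=.
rewrite big_mkcond [X in _ <= X + _]big_mkcond -big_split /=; apply: ler_sum => c _ /=.
by case: ifP => _; rewrite ?le3 ?add0r ?mulr_ge0.
Qed.

(** Suppose [d] exceeds [lam] by [e]. The sums [T i j k] measure the deficit of edges below density
    [d]: increasing indices give at least [e / 2] by counting, while the total is at most [1] by
    uniform density. For large [t] this is contradictory. *)
Lemma admissible_density_le : admissible_density (uncolorable A) d -> d <= lam.
Proof.
move=> [/andP[d0 d1] Hd]; rewrite leNgt; apply/negP => lt.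
pose e := d - lam; have e0 : 0 < e by rewrite subr_gt0.
have [t t1 larget] := binomial3_large e0.
(* The counting error is then at most [e / 2]; the summand [1] keeps the denominator positive. *)
pose eps := e / (10 * ((#|C| ^ 3)%:R + 1)).
have eps0 : 0 < eps by rewrite divr_gt0 // mulr_gt0 // ltr_wpDl.
have epsC : 5 * eps * (#|C| ^ 3)%:R <= e / 2.
  rewrite /eps; set c := (_ ^ 3)%:R; have c0 : 0 <= c by rewrite ler0n.
  have -> : 5 * (e / (10 * (c + 1))) * c = e / 2 * (c / (c + 1)) by field; lra.
  have : c / (c + 1) <= 1 by rewrite ler_pdivrMr; lra.
  by apply: ler_piMr; lra.
have [K [M HK]] := @regular_family R C eps t eps0.
(* [Q] anticipates a bound on [#|V| / kappa], with [kappa] the scaling below, so that [eta = Q ^- 3]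
   gives [eta * #|V| ^ 3 <= kappa ^ 3]. It must be fixed before [H] is known. *)
pose Q : R := 2 ^+ M * t%:R * (2 * K.+1%:R).
have t0 : 0 < t%:R :> R by rewrite ltr0n ltnW.
have pM : 0 < 2 ^+ M :> R by rewrite exprn_gt0.
have Q0 : 0 < Q by rewrite !mulr_gt0.
have eta0 : 0 < Q ^- 3 by rewrite invr_gt0 exprn_gt0.
have [H [/family_free_uncolorable[r [injr [phi phiA]]] Hdense leK]] :=
  Hd (Q ^- 3) K.+1 eta0.
set V := vertices H in r injr phi phiA leK.
pose S := (#|V| %/ K.+1)%N.
have S0 : (0 < S)%N by rewrite divn_gt0.
have KS : (K * S <= #|V|)%N.
  by apply: leq_trans (leq_divM #|V| K.+1); rewrite mulnC leq_mul2l leqnSn orbT.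
have double_ge j : (0 < j)%N -> (j < 2 * j)%N by lia.
have nS : #|V|%:R <= 2 * K.+1%:R * S%:R :> R.
  rewrite -!natrM ler_nat; have := ltn_ceil #|V| (ltn0Sn K); rewrite -/S => /ltnW le.
  by apply: leq_trans le _; rewrite mulnAC leq_mul2r double_ge ?orbT.
have [mu [pmu muS musep]] := interval_probas R injr S0 KS.
have [g [nu [gmono pnu nule nureg nuclose]]] := HK V phi mu pmu.
have nu0 i u : 0 <= nu i u := (pnu i).1 u.
(* Domination by the interval measures keeps the supports inside their intervals. *)
have nusep (i j : 'I_t) u v : (i < j)%N -> nu i u != 0 -> nu j v != 0 -> (r u < r v)%N.
  have supp k w : nu k w != 0 -> mu (g k) w != 0.
    apply: contraNneq => muk; have := nule k w; rewrite muk mulr0 => le.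
    by rewrite eq_le le nu0.
  by move=> /gmono ij /supp ui /supp vj; apply: musep ui vj ij.
pose i0 : 'I_t := Ordinal (ltnW t1); pose i1 : 'I_t := Ordinal t1.
pose x a := dens phi a (nu i0) (nu i1).
have xclose (i j : 'I_t) a : (i < j)%N -> `|dens phi a (nu i) (nu j) - x a| <= eps.
  by move=> ij; apply: nuclose.
pose E u v w : R := ([set u; v; w]%SET \in edges H)%:R.
have E01 u v w : 0 <= E u v w <= 1 by rewrite /E; case: (_ \in _); rewrite ?lexx ?ler01.
pose T (i j k : 'I_t) := \sum_u \sum_v \sum_(w | (r u < r v < r w)%N)
  (d - E u v w) * (nu i u * nu j v * nu k w).
have transversal (i j k : 'I_t) : (i < j < k)%N -> e / 2 <= T i j k.
  move=> /andP[ij jk]; have ik := ltn_trans ij jk.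
  have -> : T i j k = \sum_u \sum_v \sum_w (d - E u v w) * (nu i u * nu j v * nu k w).
    apply: eq_bigr => u _; apply: eq_bigr => v _; rewrite big_mkcond /=.
    apply: eq_bigr => w _; case: ifPn => // nlt.
    have [->|ui] := eqVneq (nu i u) 0; first by rewrite !mul0r mulr0.
    have [->|vj] := eqVneq (nu j v) 0; first by rewrite !(mulr0, mul0r).
    have [->|wk] := eqVneq (nu k w) 0; first by rewrite !mulr0.
    by case/negP: nlt; rewrite (nusep i j) // (nusep j k).
  have -> : \sum_u \sum_v \sum_w (d - E u v w) * (nu i u * nu j v * nu k w) =
      d - \sum_u \sum_v \sum_w nu i u * nu j v * nu k w * E u v w.
    have one : \sum_u \sum_v \sum_w nu i u * nu j v * nu k w = 1.
      rewrite -(proba_prod (pnu i) (pnu j)); apply: eq_bigr => u _; apply: eq_bigr => v _.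
      by rewrite -mulr_sumr (pnu k).2 mulr1.
    rewrite -[d in RHS]mulr1 -one mulr_sumr -sumrB; apply: eq_bigr => u _.
    rewrite mulr_sumr -sumrB; apply: eq_bigr => v _.
    by rewrite mulr_sumr -sumrB; apply: eq_bigr => w _; ring.
  have x0 a : 0 <= x a by apply: dens_ge0.
  have x1 : \sum_a x a = 1 by apply: sum_dens.
  have := transversal_count (pnu i) (pnu j) (pnu k) (nureg _ _ ij) (nureg _ _ ik) x0 x1
    (fun a => xclose _ _ a ij) (fun a => xclose _ _ a ik) (fun a => xclose _ _ a jk).
  have : \sum_u \sum_v \sum_w nu i u * nu j v * nu k w * E u v w <=
    \sum_u \sum_v \sum_w nu i u * nu j v * nu k w * (A (phi u v) (phi u w) (phi v w))%:R.
    apply: ler_sum => u _; apply: ler_sum => v _; apply: ler_sum => w _.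
    have [->|ui] := eqVneq (nu i u) 0; first by rewrite !mul0r.
    have [->|vj] := eqVneq (nu j v) 0; first by rewrite !(mulr0, mul0r).
    have [->|wk] := eqVneq (nu k w) 0; first by rewrite !(mulr0, mul0r).
    rewrite ler_wpM2l ?mulr_ge0 // /E; case: (boolP (_ \in _)) => // uvwE.
    by rewrite phiA // (nusep i j) // (nusep j k).
  rewrite /e in epsC *; lra.
(* If [i = j] or [j = k], the sum is at least [-1]. In the remaining non-increasing cases the
   supports admit no triple with increasing ranks, so it is [0]. *)
have Tge (i j k : 'I_t) :
    (i < j < k)%N%:R * (e / 2) - ((i == j)%:R + (j == k)%:R) <= T i j k.
  have [lt3|nlt3] := boolP (i < j < k)%N.
    have /andP[ij jk] := lt3; rewrite mul1r.
    by rewrite -!(inj_eq val_inj) /= (ltn_eqF ij) (ltn_eqF jk) addr0 subr0 transversal.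
  rewrite mul0r sub0r.
  have [eq2|] := boolP ((i == j) || (j == k)).
    apply: (@le_trans _ _ (-1)).
      by rewrite lerN2; case/orP: eq2 => ->; rewrite ?lerDl ?lerDr.
    have -> : -1 = \sum_u \sum_v \sum_w - (nu i u * nu j v * nu k w).
      rewrite -(proba_prod (pnu i) (pnu j)) -sumrN; apply: eq_bigr => u _.
      rewrite -sumrN; apply: eq_bigr => v _.
      by rewrite sumrN -mulr_sumr (pnu k).2 mulr1.
    apply: ler_sum => u _; apply: ler_sum => v _.
    rewrite [leRHS]big_mkcond; apply: ler_sum => w _ /=.
    have p0 : 0 <= nu i u * nu j v * nu k w by rewrite !mulr_ge0.
    case: ifP => _; last by rewrite oppr_le0.
    by have /andP[? ?] := E01 u v w; nra.
  rewrite negb_or => /andP[nij njk].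
  have -> : T i j k = 0; last by rewrite oppr_le0 addr_ge0.
  apply: big1 => u _; apply: big1 => v _; apply: big1 => w /andP[uv vw].
  have [->|ui] := eqVneq (nu i u) 0; first by rewrite !mul0r mulr0.
  have [->|vj] := eqVneq (nu j v) 0; first by rewrite !(mulr0, mul0r).
  have [->|wk] := eqVneq (nu k w) 0; first by rewrite !mulr0.
  case: (ltngtP i j) nij nlt3 => [ij|ji|/val_inj ->]; last by rewrite eqxx.
    case: (ltngtP j k) njk => [//|kj|/val_inj ->]; last by rewrite eqxx.
    by have := ltn_trans vw (nusep _ _ _ _ kj wk vj); rewrite ltnn.
  by have := ltn_trans uv (nusep _ _ _ _ ji vj ui); rewrite ltnn.
have total : \sum_i \sum_j \sum_k T i j k <= 1.
  pose m u := \sum_i nu i u.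
  (* At each vertex the [t] measures are at most [2 ^+ M / S], so [kappa * m] takes values in
     [[0, 1]] and is an admissible weight for [weighted_dense]. *)
  pose kappa : R := S%:R / (2 ^+ M * t%:R).
  have SR0 : 0 < S%:R :> R by rewrite ltr0n.
  have kappa0 : 0 < kappa by rewrite divr_gt0 // mulr_gt0.
  have m01 u : 0 <= kappa * m u <= 1.
    rewrite mulr_ge0 ?sumr_ge0 ?(ltW kappa0) //=.
    have : m u <= \sum_(i < t) 2 ^+ M * S%:R^-1.
      by apply: ler_sum => i _; apply: le_trans (nule i u) _; apply: ler_wpM2l (ltW pM) _ _ (muS _ _).
    rewrite sumr_const card_ord -[_ *+ t]mulr_natr => /(ler_wpM2l (ltW kappa0)) /le_trans; apply.
    have -> // : kappa * (2 ^+ M * S%:R^-1 * t%:R) = 1.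
    by rewrite /kappa; field; rewrite !gt_eqF.
  have expand (h : V -> V -> V -> R) :
      \sum_i \sum_j \sum_k \sum_u \sum_v \sum_(w | (r u < r v < r w)%N)
         h u v w * (nu i u * nu j v * nu k w)
      = \sum_u \sum_v \sum_(w | (r u < r v < r w)%N) h u v w * (m u * m v * m w).
    under eq_bigr do under eq_bigr do rewrite exchange_big /=.
    under eq_bigr do rewrite exchange_big /=.
    rewrite exchange_big /=; apply: eq_bigr => u _.
    under eq_bigr do under eq_bigr do rewrite exchange_big /=.
    under eq_bigr do rewrite exchange_big /=.
    rewrite exchange_big /=; apply: eq_bigr => v _.
    under eq_bigr do under eq_bigr do rewrite exchange_big /=.
    under eq_bigr do rewrite exchange_big /=.
    rewrite exchange_big /=; apply: eq_bigr => w _.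
    rewrite /m -mulrA !mulr_suml mulr_sumr; apply: eq_bigr => i _.
    rewrite !mulr_sumr; apply: eq_bigr => j _.
    by rewrite !mulr_sumr; apply: eq_bigr => k _; ring.
  have := weighted_dense Hdense m01.
  rewrite (sum_card3 injr) (sum_card3 injr (fun T => _ * _)).
  have -> : \sum_u \sum_v \sum_(w | (r u < r v < r w)%N)
      \prod_(x in [set u; v; w]%SET) (kappa * m x) =
    kappa ^+ 3 * \sum_u \sum_v \sum_(w | (r u < r v < r w)%N) 1 * (m u * m v * m w).
    rewrite mulr_sumr; apply: eq_bigr => u _; rewrite mulr_sumr; apply: eq_bigr => v _.
    by rewrite mulr_sumr; apply: eq_bigr => w /prod_triple ->; ring.
  have -> : \sum_u \sum_v \sum_(w | (r u < r v < r w)%N)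
      ([set u; v; w]%SET \in edges H)%:R * \prod_(x in [set u; v; w]%SET) (kappa * m x) =
    kappa ^+ 3 * \sum_u \sum_v \sum_(w | (r u < r v < r w)%N) E u v w * (m u * m v * m w).
    rewrite mulr_sumr; apply: eq_bigr => u _; rewrite mulr_sumr; apply: eq_bigr => v _.
    by rewrite mulr_sumr; apply: eq_bigr => w /prod_triple ->; rewrite /E; ring.
  rewrite expand.
  have -> : \sum_u \sum_v \sum_(w | (r u < r v < r w)%N) (d - E u v w) * (m u * m v * m w)
    = d * (\sum_u \sum_v \sum_(w | (r u < r v < r w)%N) 1 * (m u * m v * m w))
     - \sum_u \sum_v \sum_(w | (r u < r v < r w)%N) E u v w * (m u * m v * m w).
    rewrite mulr_sumr -sumrB; apply: eq_bigr => u _; rewrite mulr_sumr -sumrB.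
    by apply: eq_bigr => v _; rewrite mulr_sumr -sumrB; apply: eq_bigr => w _; ring.
  have err : Q ^- 3 * #|V|%:R ^+ 3 <= kappa ^+ 3.
    have kQ : #|V|%:R <= kappa * Q.
      suff -> : kappa * Q = 2 * K.+1%:R * S%:R by [].
      by rewrite /kappa /Q; field; rewrite !gt_eqF.
    rewrite mulrC ler_pdivrMr ?exprn_gt0 // -exprMn.
    by rewrite lerXn2r ?nnegrE // (le_trans _ kQ).
  set X := \sum_u _; set Y := \sum_u _ => le.
  have k3 : 0 < kappa ^+ 3 by rewrite exprn_gt0.
  rewrite -(ler_pM2l k3) mulr1; lra.
have := ler_sum (index_enum 'I_t) (fun i (_ : true) => ler_sum (index_enum 'I_t)
  (fun j (_ : true) => ler_sum (index_enum 'I_t) (fun k (_ : true) => Tge i j k))).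
move=> /le_trans /(_ total).
have -> : \sum_(i < t) \sum_(j < t) \sum_(k < t)
     ((i < j < k)%N%:R * (e / 2) - ((i == j)%:R + (j == k)%:R)) =
   'C(t, 3)%:R * (e / 2) - 2 * t%:R ^+ 2.
  have -> : 'C(t, 3)%:R = \sum_(i < t) \sum_(j < t) \sum_(k < t) (i < j < k)%N%:R :> R.
    rewrite -[t in LHS]card_ord -card_draws -sum1_card natr_sum.
    rewrite (eq_bigl (fun B : {set 'I_t} => #|B| == 3)); last by move=> B; rewrite inE.
    rewrite (sum_card3 (@ord_inj t)); apply: eq_bigr => i _; apply: eq_bigr => j _.
    by rewrite big_mkcond; apply: eq_bigr => k _; case: ifP.
  have one (i : 'I_t) : \sum_j (i == j)%:R = 1 :> R.
    by rewrite (bigD1 i) //= eqxx big1 ?addr0 // => j; rewrite eq_sym => /negbTE ->.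
  have -> : 2 * t%:R ^+ 2 = \sum_(i < t) \sum_(j < t) \sum_(k < t) ((i == j)%:R + (j == k)%:R) :> R.
    under eq_bigr do under eq_bigr do rewrite big_split /=.
    under eq_bigr do rewrite big_split /=.
    rewrite big_split /= mulrDl mul1r; congr (_ + _).
      under eq_bigr do under eq_bigr do rewrite sumr_const card_ord.
      by under eq_bigr do rewrite sumrMnl one; rewrite !sumr_const card_ord expr2 mulr_natr.
    under eq_bigr do under eq_bigr do rewrite one.
    by rewrite !sumr_const card_ord expr2 mulr_natr.
  rewrite mulr_suml -sumrB; apply: eq_bigr => i _.
  rewrite mulr_suml -sumrB; apply: eq_bigr => j _.
  by rewrite mulr_suml -sumrB.
by lra.
Qed.

End UpperBound.

(** * Random colourings *)

Lemma sqr_sum_le (R : realType) (I : finType) (z : I -> R) :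
  (\sum_i z i) ^+ 2 <= #|I|%:R * \sum_i z i ^+ 2.
Proof.
have : 0 <= \sum_i \sum_j (z i - z j) ^+ 2.
  by do 2!apply: sumr_ge0 => ? _; apply: sqr_ge0.
have -> : \sum_i \sum_j (z i - z j) ^+ 2 =
    2 * (#|I|%:R * \sum_i z i ^+ 2) - 2 * (\sum_i z i) ^+ 2.
  transitivity (\sum_i (#|I|%:R * z i ^+ 2 + \sum_j z j ^+ 2 - 2 * z i * \sum_j z j)).
    apply: eq_bigr => i _; rewrite mulr_sumr.
    have -> : #|I|%:R * z i ^+ 2 = \sum_(j : I) z i ^+ 2 by rewrite sumr_const mulr_natl.
    by rewrite -big_split -sumrB; apply: eq_bigr => j _ /=; ring.
  rewrite sumrB big_split /= -mulr_sumr -mulr_suml -mulr_sumr sumr_const -mulr_natl; ring.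
by lra.
Qed.

Section RandomColouring.
Variables (R : realType) (C : finType) (N n : nat) (pi : 'I_N.+1 -> C).
Local Notation D := 'I_N.+1.
Local Notation Omega := {ffun 'I_n * 'I_n -> D}.

(** Colours are sampled by applying [pi] to uniform elements of [D], so expectations are plain sums
    over [Omega]; the weights that arise are rational. *)
Definition colour_weight (a : C) : R := (\sum_d (pi d == a)%:R) / N.+1%:R.

Lemma colour_weight_ge0 a : 0 <= colour_weight a.
Proof. by rewrite divr_ge0 ?sumr_ge0. Qed.

Lemma sum_colour_weight : \sum_a colour_weight a = 1.
Proof.
rewrite -mulr_suml exchange_big /=.
under eq_bigr => d _.
  rewrite (bigD1 (pi d)) //= eqxx big1 ?addr0; last first.
    by move=> a; rewrite eq_sym => /negbTE ->.
  over.
by rewrite sumr_const card_ord divff // pnatr_eq0.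
Qed.

Lemma colour_weight_le1 a : colour_weight a <= 1.
Proof.
rewrite -sum_colour_weight (bigD1 a) //= lerDl sumr_ge0 // => b _.
exact: colour_weight_ge0.
Qed.

Definition deviation a (d : D) : R := (pi d == a)%:R - colour_weight a.

Lemma sum_deviation a : \sum_d deviation a d = 0.
Proof.
rewrite sumrB sumr_const card_ord -[_ *+ N.+1]mulr_natr.
by rewrite divfK ?pnatr_eq0 // subrr.
Qed.

Lemma deviation_le1 a d : `|deviation a d| <= 1.
Proof.
have := colour_weight_ge0 a; have := colour_weight_le1 a.
rewrite /deviation ler_norml; case: (_ == _) => /=; move=> *; apply/andP; split; lra.
Qed.

(** Translating one coordinate in the cyclic group [D] expresses independence: a function invariant
    under these shifts does not depend on that coordinate. *)
Definition shift (e : 'I_n * 'I_n) (t : D) (omega : Omega) : Omega :=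
  [ffun e' => omega e' + (if e' == e then t else 0)].

Lemma shift_inj e t : injective (shift e t).
Proof.
move=> w w' /ffunP eqw; apply/ffunP => e'; have := eqw e'.
by rewrite !ffunE => /addIr.
Qed.

(** Average over all shifts of coordinate [e]: [h] stays fixed while [g] runs through all its
    values, which sum to [0]. *)
Lemma sum_independent e (g : D -> R) (h : Omega -> R) :
  \sum_d g d = 0 -> (forall w t, h (shift e t w) = h w) ->
  \sum_(w : Omega) g (w e) * h w = 0.
Proof.
move=> g0 hshift; set S := (X in X = 0).
suff /eqP : S *+ N.+1 = 0 by rewrite mulrn_eq0 => /eqP.
have -> : S *+ N.+1 = \sum_(t : D) \sum_(w : Omega) g (w e + t) * h w.
  rewrite -[N.+1 in LHS]card_ord -sumr_const; apply: eq_bigr => t _.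
  rewrite /S (reindex_inj (@shift_inj e t)); apply: eq_bigr => w _.
  by rewrite hshift ffunE eqxx.
rewrite exchange_big big1 // => w _; rewrite -mulr_suml.
by have := g0; rewrite (reindex_inj (addrI (w e))) /= => ->; rewrite mul0r.
Qed.

Definition kernel (w : Omega) a (u v : 'I_n) : R :=
  if (u < v)%N then deviation a (w (u, v)) else 0.

Lemma kernel_le1 w a u v : `|kernel w a u v| <= 1.
Proof. by rewrite /kernel; case: ifP => _; rewrite ?deviation_le1 ?normr0. Qed.

(** The signed count of 4-cycles of the kernel, degenerate ones included, which controls its cut
    norm. *)
Definition codegree_energy (w : Omega) a :=
  \sum_u \sum_u' (\sum_v kernel w a u v * kernel w a u' v) ^+ 2.

Lemma codegree_energy_ge0 w a : 0 <= codegree_energy w a.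
Proof. by do 2!apply: sumr_ge0 => ? _; apply: sqr_ge0. Qed.

(* The four factors are independent and centred unless u = u' or v = v'. *)
Lemma sum_codegree_energy a :
  \sum_(w : Omega) codegree_energy w a <= #|Omega|%:R * (2 * n%:R ^+ 3).
Proof.
have -> : \sum_(w : Omega) codegree_energy w a = \sum_u \sum_u' \sum_v \sum_v' \sum_w
    kernel w a u v * (kernel w a u' v * kernel w a u v' * kernel w a u' v').
  rewrite /codegree_energy exchange_big; apply: eq_bigr => u _.
  rewrite exchange_big; apply: eq_bigr => u' _ /=.
  transitivity (\sum_(w : Omega) \sum_v \sum_v' 
    kernel w a u v * (kernel w a u' v * kernel w a u v' * kernel w a u' v')).
    apply: eq_bigr => w _; rewrite expr2 mulr_suml; apply: eq_bigr => v _.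
    by rewrite mulr_sumr; apply: eq_bigr => v' _; ring.
  rewrite exchange_big; apply: eq_bigr => v _.
  by rewrite exchange_big.
have bound u u' v v' :
    \sum_(w : Omega) kernel w a u v * (kernel w a u' v * kernel w a u v' * kernel w a u' v')
    <= #|Omega|%:R * ((u == u')%:R + (v == v')%:R).
  have [deg|/norP[uu' vv']] := boolP ((u == u') || (v == v')).
    apply: (@le_trans _ _ #|Omega|%:R); last first.
      by rewrite ler_peMr //; case/orP: deg => ->; rewrite ?lerDl ?lerDr.
    rewrite -sumr_const; apply: ler_sum => w _; apply: le_trans (ler_norm _) _.
    by rewrite !normrM !mulr_ile1 ?mulr_ge0 ?kernel_le1.
  apply: (@le_trans _ _ 0); last by rewrite mulr_ge0 ?addr_ge0.
  have [uv|nuv] := boolP (u < v)%N; last first.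
    by rewrite big1 // => w _; rewrite {1}/kernel (negbTE nuv) mul0r.
  rewrite le_eqVlt; apply/orP; left; apply/eqP.
  under eq_bigr do rewrite {1}/kernel uv.
  (* Coordinate [(u, v)] enters only the first factor, because [u != u'] and [v != v']. *)
  apply: (@sum_independent (u, v) (deviation a) (fun w => kernel w a u' v * kernel w a u v' * kernel w a u' v')).
    exact: sum_deviation.
  move=> w t; congr (_ * _ * _); rewrite /kernel ffunE xpair_eqE.
  - by rewrite eq_sym (negbTE uu') addr0.
  - by rewrite andbC eq_sym (negbTE vv') addr0.
  - by rewrite eq_sym (negbTE uu') addr0.
apply: (@le_trans _ _ (\sum_(u < n) \sum_(u' < n) \sum_(v < n) \sum_(v' < n)
    #|Omega|%:R * ((u == u')%:R + (v == v')%:R))).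
  by do 4!apply: ler_sum => ? _; apply: bound.
rewrite le_eqVlt; apply/orP; left; apply/eqP.
have one (i : 'I_n) : \sum_j (i == j)%:R = 1 :> R.
  by rewrite (bigD1 i) //= eqxx big1 ?addr0 // => j; rewrite eq_sym => /negbTE ->.
under eq_bigr do under eq_bigr do under eq_bigr do
  rewrite -mulr_sumr big_split /= one sumr_const card_ord.
under eq_bigr do under eq_bigr do
  rewrite -mulr_sumr big_split /= !sumr_const !card_ord.
under eq_bigr do
  rewrite -mulr_sumr big_split /= !sumrMnl one !sumr_const !card_ord.
by rewrite sumr_const card_ord -(mulr_natr n%:R n) -[LHS]mulr_natr; ring.
Qed.

(** Averaging the sum over all colours yields one outcome that serves every colour, at the cost of
    the factor [#|C|]. *)
Lemma exists_quasirandom :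
  exists w : Omega, forall a, codegree_energy w a <= 2 * #|C|%:R * n%:R ^+ 3.
Proof.
have [w lew] : exists w : Omega, \sum_a codegree_energy w a <= 2 * #|C|%:R * n%:R ^+ 3.
  apply: contrapT => /forallNP lt.
  have : \sum_(w : Omega) 2 * #|C|%:R * n%:R ^+ 3 < \sum_(w : Omega) \sum_a codegree_energy w a :> R.
    apply: ltr_sum => [|w _]; last by rewrite ltNge; apply/negP/lt.
    by apply/hasP; exists [ffun=> 0]; rewrite ?mem_index_enum.
  rewrite exchange_big /= ltNge => /negP; apply.
  apply: (@le_trans _ _ (\sum_(a : C) #|Omega|%:R * (2 * n%:R ^+ 3))).
    by apply: ler_sum => a _; apply: sum_codegree_energy.
  by rewrite !sumr_const -[leLHS]mulr_natr -[leRHS]mulr_natr le_eqVlt; apply/orP; left; apply/eqP; ring.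
exists w => a; apply: le_trans lew; rewrite (bigD1 a) //= lerDl.
by apply: sumr_ge0 => b _; apply: codegree_energy_ge0.
Qed.

(** Cauchy-Schwarz twice: over [v] to remove [G], then over the pairs [(u, u')] to remove [F]. *)
Lemma kernel_cut (w : Omega) a (F G : 'I_n -> R) :
  (forall u, 0 <= F u <= 1) -> (forall v, 0 <= G v <= 1) ->
  (\sum_u \sum_v F u * G v * kernel w a u v) ^+ 4 <= n%:R ^+ 4 * codegree_energy w a.
Proof.
move=> F01 G01; pose y v := \sum_u F u * kernel w a u v.
have sq1 (E z : R) : 0 <= E <= 1 -> (E * z) ^+ 2 <= z ^+ 2.
  move=> /andP[E0 E1]; rewrite exprMn ler_piMl ?sqr_ge0 //.
  by rewrite expr_le1.
have -> : \sum_u \sum_v F u * G v * kernel w a u v = \sum_v G v * y v.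
  rewrite exchange_big; apply: eq_bigr => v _; rewrite mulr_sumr.
  by apply: eq_bigr => u _ /=; ring.
have Y0 : 0 <= \sum_v y v ^+ 2 by apply: sumr_ge0 => v _; apply: sqr_ge0.
have le1 : (\sum_v G v * y v) ^+ 2 <= n%:R * \sum_v y v ^+ 2.
  apply: le_trans (sqr_sum_le _) _; rewrite card_ord ler_wpM2l //.
  by apply: ler_sum => v _; apply: sq1.
have -> : (\sum_v G v * y v) ^+ 4 = ((\sum_v G v * y v) ^+ 2) ^+ 2 by rewrite -exprM.
apply: (@le_trans _ _ ((n%:R * \sum_v y v ^+ 2) ^+ 2)).
  by rewrite lerXn2r ?nnegrE ?sqr_ge0 ?mulr_ge0.
have -> : \sum_v y v ^+ 2 =
    \sum_(p : 'I_n * 'I_n) F p.1 * F p.2 * \sum_v kernel w a p.1 v * kernel w a p.2 v.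
  rewrite -(pair_bigA _ (fun u u' => F u * F u' * \sum_v kernel w a u v * kernel w a u' v)) /=.
  under [RHS]eq_bigr do under eq_bigr do rewrite mulr_sumr.
  under [RHS]eq_bigr do rewrite exchange_big /=.
  rewrite [RHS]exchange_big /=; apply: eq_bigr => v _.
  rewrite expr2 mulr_suml; apply: eq_bigr => u _; rewrite mulr_sumr.
  by apply: eq_bigr => u' _; ring.
rewrite exprMn (_ : n%:R ^+ 4 = n%:R ^+ 2 * n%:R ^+ 2); last by ring.
rewrite -mulrA ler_wpM2l ?exprn_ge0 //.
apply: le_trans (sqr_sum_le _) _.
rewrite card_prod card_ord natrM -expr2 ler_wpM2l ?exprn_ge0 // /codegree_energy.
rewrite (pair_bigA _ (fun u u' => (\sum_v kernel w a u v * kernel w a u' v) ^+ 2)) /=.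
apply: ler_sum => p _; apply: sq1.
by have /andP[? ?] := F01 p.1; have /andP[? ?] := F01 p.2; rewrite mulr_ge0 ?mulr_ile1.
Qed.

Section Counting.
Variables (w : Omega) (delta : R) (U : {set 'I_n}).
Hypothesis cut : forall a (F G : 'I_n -> R),
  (forall u, 0 <= F u <= 1) -> (forall v, 0 <= G v <= 1) ->
  - (delta * n%:R ^+ 2) <= \sum_u \sum_v F u * G v * kernel w a u v.

Let phi u v := pi (w (u, v)).
Let mem u : R := (u \in U)%:R.

Lemma bool01 (b : bool) : 0 <= (b%:R : R) <= 1.
Proof. by case: b; rewrite /= ?ler01 ?lexx. Qed.

Lemma mul01 (x y : R) : 0 <= x <= 1 -> 0 <= y <= 1 -> 0 <= x * y <= 1.
Proof. by move=> /andP[? ?] /andP[? ?]; rewrite mulr_ge0 ?mulr_ile1. Qed.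

Lemma scale_lower (c S : R) : 0 <= c <= 1 -> 0 <= delta ->
  - (delta * n%:R ^+ 2) <= S -> - (delta * n%:R ^+ 2) <= c * S.
Proof.
move=> /andP[c0 c1] del0 leS; have [S0|/ltW S0] := leP 0 S.
  by apply: (@le_trans _ _ 0); rewrite ?mulr_ge0 // oppr_le0 mulr_ge0 ?exprn_ge0.
apply: le_trans leS _; rewrite -subr_ge0.
have -> : c * S - S = (1 - c) * - S by ring.
by rewrite mulr_ge0; lra.
Qed.

(** The indicators are replaced by weights one at a time. The errors [S1], [S2], [S3] fix the third,
    second and first vertex respectively; each is a sum of [n] cut sums, since the order conditions
    not supplied by the kernel can be put into [F] and [G]. *)
Lemma pattern_count a b c : 0 <= delta ->
  colour_weight a * colour_weight b * colour_weight c *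
    (\sum_(u < n) \sum_(v < n) \sum_(x < n | (u < v < x)%N) mem u * mem v * mem x) -
  3 * delta * n%:R ^+ 3 <=
  \sum_(u < n) \sum_(v < n) \sum_(x < n | (u < v < x)%N)
    mem u * mem v * mem x * ((phi u v == a)%:R * (phi u x == b)%:R * (phi v x == c)%:R).
Proof.
move=> del0.
pose xa := colour_weight a; pose xb := colour_weight b; pose xc := colour_weight c.
have x01 d : 0 <= colour_weight d <= 1 by rewrite colour_weight_ge0 colour_weight_le1.
pose S1 (x : 'I_n) := mem x * \sum_(u < n) \sum_(v < n) (mem u * (phi u x == b)%:R) *
   (mem v * (phi v x == c)%:R * (v < x)%N%:R) * kernel w a u v.
pose S2 (v : 'I_n) := xa * mem v * \sum_(u < n) \sum_(x < n) (mem u * (u < v)%N%:R) *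
   (mem x * (phi v x == c)%:R * (v < x)%N%:R) * kernel w b u x.
pose S3 (u : 'I_n) := xa * xb * mem u * \sum_(v < n) \sum_(x < n) (mem v * (u < v)%N%:R) * mem x * kernel w c v x.
have S1ge x : - (delta * n%:R ^+ 2) <= S1 x.
  by apply: scale_lower => //; [exact: bool01 | apply: cut => ?; rewrite !mul01 ?bool01].
have S2ge x : - (delta * n%:R ^+ 2) <= S2 x.
  by apply: scale_lower => //; [apply: mul01; rewrite ?x01 ?bool01 | apply: cut => ?; rewrite !mul01 ?bool01].
have S3ge x : - (delta * n%:R ^+ 2) <= S3 x.
  by apply: scale_lower => //; [apply: mul01; [apply: mul01|]; rewrite ?x01 ?bool01 | apply: cut => ?; rewrite ?mul01 ?bool01].
have total (S : 'I_n -> R) : (forall x, - (delta * n%:R ^+ 2) <= S x) ->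
    - (delta * n%:R ^+ 3) <= \sum_x S x.
  move=> Sge; have -> : - (delta * n%:R ^+ 3) = \sum_(x < n) - (delta * n%:R ^+ 2).
    by rewrite sumr_const card_ord -[RHS]mulr_natr; ring.
  by apply: ler_sum => x _.
have h1 := total _ S1ge; have h2 := total _ S2ge; have h3 := total _ S3ge.
pose P (u v x : 'I_n) (f : R) : R := if (u < v < x)%N then mem u * mem v * mem x * f else 0.
have e1 : \sum_x S1 x = \sum_u \sum_v \sum_x
    P u v x (((phi u v == a)%:R - xa) * (phi u x == b)%:R * (phi v x == c)%:R).
  under eq_bigr do rewrite /S1 mulr_sumr.
  rewrite exchange_big; apply: eq_bigr => u _ /=.
  under eq_bigr do rewrite mulr_sumr.
  rewrite exchange_big; apply: eq_bigr => v _ /=; apply: eq_bigr => x _.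
  rewrite /P /kernel /deviation /xa /phi; case: (u < v)%N; case: (v < x)%N => /=; ring.
have e2 : \sum_v S2 v = \sum_u \sum_v \sum_x
    P u v x (xa * ((phi u x == b)%:R - xb) * (phi v x == c)%:R).
  under eq_bigr do rewrite /S2 mulr_sumr.
  rewrite exchange_big; apply: eq_bigr => u _ /=; apply: eq_bigr => v _.
  rewrite mulr_sumr; apply: eq_bigr => x _.
  rewrite /P /kernel /deviation /xb /phi.
  case: (ltnP u v) => uv; case: (ltnP v x) => vx; rewrite ?(ltn_trans uv vx) /=; ring.
have e3 : \sum_u S3 u = \sum_u \sum_v \sum_x P u v x (xa * xb * ((phi v x == c)%:R - xc)).
  apply: eq_bigr => u _; rewrite /S3 mulr_sumr; apply: eq_bigr => v _.
  rewrite mulr_sumr; apply: eq_bigr => x _.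
  rewrite /P /kernel /deviation /xc /phi; case: (u < v)%N; case: (v < x)%N => /=; ring.
have -> : \sum_(u < n) \sum_(v < n) \sum_(x < n | (u < v < x)%N)
    mem u * mem v * mem x * ((phi u v == a)%:R * (phi u x == b)%:R * (phi v x == c)%:R) =
    xa * xb * xc * (\sum_(u < n) \sum_(v < n) \sum_(x < n | (u < v < x)%N) mem u * mem v * mem x)
    + (\sum_x S1 x + \sum_v S2 v + \sum_u S3 u).
  rewrite e1 e2 e3 mulr_sumr -!big_split; apply: eq_bigr => u _ /=.
  rewrite mulr_sumr -!big_split; apply: eq_bigr => v _ /=.
  rewrite mulr_sumr big_mkcond [X in _ = X + _]big_mkcond -!big_split.
  apply: eq_bigr => x _ /=; rewrite /P; case: (_ && _); last by rewrite !addr0.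
  ring.
rewrite -/xa -/xb -/xc; move: h1 h2 h3.
move: (\sum_x S1 x) (\sum_x S2 x) (\sum_x S3 x) (xa * xb * xc * _) => s1 s2 s3 t.
by lra.
Qed.

End Counting.

End RandomColouring.

(** * The 3-graph of allowed triples of a colouring *)

Section PatternGraph.
Variables (C : finType) (A : C -> C -> C -> bool) (n : nat) (phi : 'I_n -> 'I_n -> C).

Definition pattern_edges : {set {set 'I_n}} :=
  [set T | [exists p : 'I_n * 'I_n * 'I_n, [&& (p.1.1 < p.1.2 < p.2)%N,
     T == [set p.1.1; p.1.2; p.2]%SET &
     A (phi p.1.1 p.1.2) (phi p.1.1 p.2) (phi p.1.2 p.2)]]]%SET.

Lemma mem_pattern_edges (u v w : 'I_n) : (u < v < w)%N ->
  ([set u; v; w]%SET \in pattern_edges) = A (phi u v) (phi u w) (phi v w).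
Proof.
move=> uvw; rewrite inE; apply/existsP/idP => [[[[u' v'] w']] /=|Auvw].
  by case/and3P => uvw' /eqP /(sorted_triple_inj uvw uvw') [-> -> ->].
by exists (u, v, w); rewrite /= uvw eqxx Auvw.
Qed.

Lemma pattern_edges_sub : pattern_edges \subset ksubsets [set: 'I_n]%SET 3.
Proof.
apply/fintype.subsetP => T; rewrite !inE finset.subsetT => /existsP[[[u v] w]] /=.
case/and3P => uvw /eqP -> _.
by rewrite (card_sorted_triple uvw).
Qed.

Definition pattern_graph := HGraph3 pattern_edges_sub.

Lemma pattern_graph_colorable : colorable A pattern_graph.
Proof.
exists (@nat_of_ord n); split; first exact: ord_inj.
by exists phi => u v w uvw; rewrite mem_pattern_edges.
Qed.

End PatternGraph.

Lemma palette_density01 (R : realType) (C : finType) (A : C -> C -> C -> bool) (x : C -> R) :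
  (forall a, 0 <= x a) -> \sum_a x a = 1 -> 0 <= palette_density A x <= 1.
Proof.
move=> x0 x1; apply/andP; split.
  by do 3!apply: sumr_ge0 => ? _; rewrite !mulr_ge0.
have <- : \sum_a \sum_b \sum_c x a * x b * x c = 1.
  under eq_bigr do under eq_bigr do rewrite -mulr_sumr x1 mulr1.
  by under eq_bigr do rewrite -mulr_sumr x1 mulr1.
do 2!apply: ler_sum => ? _; rewrite big_mkcond; apply: ler_sum => ? _.
by case: ifP => // _; rewrite !mulr_ge0.
Qed.

Section LowerBound.
Variables (R : realType) (C : finType) (A : C -> C -> C -> bool).
Variables (N : nat) (pi : 'I_N.+1 -> C).

Lemma palette_admissible :
  admissible_density (uncolorable A) (palette_density A (@colour_weight R C N pi)).
Proof.
set x := colour_weight _ _; set p := palette_density _ _.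
have x0 a : 0 <= x a by apply: colour_weight_ge0.
split; first by apply: palette_density01 => //; apply: sum_colour_weight.
move=> eta m eta0.
pose K : R := (#|C| ^ 3)%:R.
have K0 : 0 <= K by rewrite ler0n.
(* [pattern_count] loses [3 * delta * n ^ 3] for each of at most [#|C| ^ 3] patterns; together this
   is at most [eta * n ^ 3]. *)
pose delta := eta / (3 * (K + 1)).
have delta0 : 0 < delta by rewrite divr_gt0 // mulr_gt0 // ltr_wpDl.
have delta_eta : 3 * delta * K <= eta.
  rewrite /delta (_ : 3 * _ * K = eta * (K / (K + 1))); last by field; lra.
  have : K / (K + 1) <= 1 by rewrite ler_pdivrMr; lra.
  by move=> ?; rewrite ler_piMr // ltW.
(* For such [n] the codegree bound [2 * #|C| * n ^ 3] is at most [delta ^ 4 * n ^ 4], which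
   [kernel_cut] turns into a cut bound [delta * n ^ 2]. *)
pose n := maxn m (Num.truncn (2 * #|C|%:R / delta ^+ 4)).+1.
have n0 : 0 < n%:R :> R by rewrite ltr0n leq_max orbT.
have nbig : 2 * #|C|%:R <= delta ^+ 4 * n%:R.
  rewrite -ler_pdivrMl ?exprn_gt0 // mulrC ltW //; apply: lt_le_trans (truncnS_gt _) _.
  by rewrite ler_nat leq_maxr.
have [w qr] := @exists_quasirandom R C N n pi.
have cut a (F G : 'I_n -> R) :
  (forall u, 0 <= F u <= 1) -> (forall v, 0 <= G v <= 1) ->
  - (delta * n%:R ^+ 2) <= \sum_u \sum_v F u * G v * kernel R pi w a u v.
  move=> F01 G01; set Z := \sum_u _.
  have Z4 : Z ^+ 4 <= (delta * n%:R ^+ 2) ^+ 4.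
    apply: le_trans (kernel_cut pi w a F01 G01) _.
    apply: (@le_trans _ _ (n%:R ^+ 4 * (delta ^+ 4 * n%:R * n%:R ^+ 3))).
      rewrite ler_wpM2l ?exprn_ge0 //; apply: le_trans (qr a) _.
      by rewrite ler_wpM2r ?exprn_ge0.
    by rewrite le_eqVlt; apply/orP; left; apply/eqP; ring.
  have : `|Z| <= delta * n%:R ^+ 2.
    have b0 : 0 <= delta * n%:R ^+ 2 by rewrite ltW // mulr_gt0 ?exprn_gt0.
    by rewrite -(ler_pXn2r (n := 4)) ?nnegrE // -normrX ger0_norm ?exprn_even_ge0.
  by rewrite ler_norml => /andP[].
pose phi u v := pi (w (u, v)).
exists (pattern_graph A phi); split.
- exact/family_free_uncolorable/pattern_graph_colorable.
- move=> U; rewrite (binomial_sum R (H := pattern_graph A phi)) card_induced_edges.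
  rewrite !(sum_card3 (@ord_inj n)) /=.
  pose mem (u : 'I_n) : R := (u \in U)%:R.
  have sub3 (u v z : 'I_n) : ([set u; v; z]%SET \subset U)%:R = mem u * mem v * mem z.
    rewrite !finset.subUset !finset.sub1set /mem.
    by case: (u \in U); case: (v \in U); case: (z \in U); rewrite /= ?(mulr1, mulr0).
  set T := \sum_u \sum_v \sum_(z | _) _.
  have -> : T = \sum_(u < n) \sum_(v < n) \sum_(z < n | (u < v < z)%N) mem u * mem v * mem z.
    by do 3!apply: eq_bigr => ? _; rewrite sub3.
  set E := (X in _ <= X).
  have -> : E = \sum_a \sum_b \sum_(c | A a b c)
     \sum_(u < n) \sum_(v < n) \sum_(z < n | (u < v < z)%N)
     mem u * mem v * mem z * ((phi u v == a)%:R * (phi u z == b)%:R * (phi v z == c)%:R).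
    under [RHS]eq_bigr do under eq_bigr do rewrite exchange_big /=.
    under [RHS]eq_bigr do rewrite exchange_big /=.
    rewrite [RHS]exchange_big /=; apply: eq_bigr => u _.
    under [RHS]eq_bigr do under eq_bigr do rewrite exchange_big /=.
    under [RHS]eq_bigr do rewrite exchange_big /=.
    rewrite [RHS]exchange_big /=; apply: eq_bigr => v _.
    under [RHS]eq_bigr do under eq_bigr do rewrite exchange_big /=.
    under [RHS]eq_bigr do rewrite exchange_big /=.
    rewrite [RHS]exchange_big /=; apply: eq_bigr => z uvz.
    rewrite mem_pattern_edges // sub3 sum_patterns.
    by rewrite mulrC.
  have -> : p * (\sum_(u < n) \sum_(v < n) \sum_(z < n | (u < v < z)%N) mem u * mem v * mem z)
      - eta * #|'I_n|%:R ^+ 3 =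
    \sum_a \sum_b \sum_(c | A a b c) (x a * x b * x c *
     (\sum_(u < n) \sum_(v < n) \sum_(z < n | (u < v < z)%N) mem u * mem v * mem z))
     - eta * n%:R ^+ 3.
    rewrite card_ord /p /palette_density; congr (_ - _).
    rewrite mulr_suml; apply: eq_bigr => a _; rewrite mulr_suml; apply: eq_bigr => b _.
    by rewrite mulr_suml.
  apply: (@le_trans _ _ (\sum_a \sum_b \sum_(c | A a b c) (x a * x b * x c *
     (\sum_(u < n) \sum_(v < n) \sum_(z < n | (u < v < z)%N) mem u * mem v * mem z)
     - 3 * delta * n%:R ^+ 3))); last first.
    by do 3!apply: ler_sum => ? _; exact: (pattern_count U cut _ _ _ (ltW delta0)).
  under [leRHS]eq_bigr do under eq_bigr do rewrite sumrB.
  under [leRHS]eq_bigr do rewrite sumrB.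
  rewrite sumrB lerD2l lerN2.
  apply: (@le_trans _ _ (\sum_(a : C) \sum_(b : C) \sum_(c : C) 3 * delta * n%:R ^+ 3)).
    do 2!apply: ler_sum => ? _; rewrite big_mkcond; apply: ler_sum => ? _.
    case: ifP => // _; apply: mulr_ge0; last by rewrite exprn_ge0 // ltW.
    by rewrite mulr_ge0 // ltW.
  rewrite !sumr_const -!mulrnA -[leLHS]mulr_natr.
  rewrite (_ : (_ * _)%N%:R = K); last by rewrite /K !expnS expn0 muln1 mulnA.
  by rewrite mulrAC ler_wpM2r // ltW // exprn_gt0.
by rewrite card_ord leq_maxl.
Qed.
End LowerBound.

(** * The chain palettes *)

Lemma big_option (M : Type) (idx : M) (op : Monoid.com_law idx) (T : finType)
    (F : option T -> M) :
  \big[op/idx]_c F c = op (F None) (\big[op/idx]_t F (Some t)).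
Proof.
rewrite (bigD1 None) //=; congr (op _ _).
rewrite (reindex_omap Some id) /=; last by case.
by apply: eq_bigl => t; rewrite eqxx.
Qed.

(** List each colour [a] exactly [y a] times and let [pi] enumerate the list. *)
Lemma exists_colouring (R : realType) (C : finType) (y : C -> nat) :
  (0 < \sum_a y a)%N -> exists N (pi : 'I_N.+1 -> C),
    forall a, colour_weight R pi a = (y a)%:R / (\sum_a y a)%:R.
Proof.
pose l := flatten [seq nseq (y a) a | a <- enum C].
have szl : size l = (\sum_a y a)%N.
  rewrite size_flatten /shape -map_comp sumnE big_map big_enum.
  by apply: eq_bigr => a _ /=; rewrite size_nseq.
have cnt a : count_mem a l = y a.
  rewrite count_flatten -map_comp sumnE big_map big_enum (bigD1 a) //=.
  rewrite count_nseq /= eqxx mul1n big1 ?addn0 // => b ba.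
  by rewrite count_nseq /= (negbTE ba).
rewrite -szl; case: l szl cnt => [//|a0 l] _ cnt _.
exists (size l), (fun d => nth a0 (a0 :: l) d) => a.
congr (_ / _); rewrite -cnt -sum1_count natr_sum [RHS]big_mkcond (big_nth a0) big_mkord.
by apply: eq_bigr => d _ /=; case: eqP.
Qed.

Section ChainPalette.
Variable m : nat.
Local Notation X := ('I_m.+2 * bool)%type.

(* Write x_al for the weight of al.  The number of allowed triples with the special
   colour None and the two colours al <> be is 5, or 6 in adjacent blocks; with
   None and al twice it is loops.  Since each block has two colours, a block of
   weight Y contributes (loops / 2 + 5 / 4) Y^2 when balanced; relative to
   5/2 Y^2, its losses are 1/4 (first), 5/4 (inner) and 3/4 (last), as needed for
   sum_j (2 Y_(j+1) - Y_j)^2 - Y_last^2. *)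
Definition loops (a : nat) : nat := (if a == 0 then 2 else a == m.+1)%N.

Definition adjacent (a b : nat) : bool := (a.+1 == b) || (b.+1 == a).

Definition before (al be : X) : bool :=
  (al.1 < be.1)%N || (al.1 == be.1) && (~~ al.2 && be.2).

(** [p] is the position of [None] in the triple. As [before] is a strict linear order, exactly one
    of the six arrangements is dropped for distinct colours in non-adjacent blocks. *)
Definition pair_allowed (p : nat) (al be : X) : bool :=
  if al == be then (p < loops al.1)%N
  else adjacent al.1 be.1 || ~~ ((p == 0)%N && before al be).

Definition chain_palette (a b c : option X) : bool :=
  match a, b, c with
  | None, Some al, Some be => pair_allowed 0 al be
  | Some al, None, Some be => pair_allowed 1 al be
  | Some al, Some be, None => pair_allowed 2 al be
  | _, _, _ => false
  end.

(** Both orders of the two colours are counted, as in a symmetrized quadratic form. The diagonal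
    correction [5] is added on the left to avoid subtraction of naturals. *)
Lemma sum_pair_allowed (al be : X) :
  (\sum_(p < 3) (pair_allowed p al be + pair_allowed p be al) + (al == be) * 5 =
   5 + adjacent al.1 be.1 + (al == be) * (2 * loops al.1))%N.
Proof.
rewrite !big_ord_recr big_ord0 /= /pair_allowed (eq_sym be).
have [<-|neq] := eqVneq al be.
  have -> : adjacent al.1 al.1 = false by apply/negbTE; rewrite /adjacent; lia.
  have : (loops al.1 <= 2)%N by rewrite /loops; case: ifP => // _; case: (_ == _ :> nat).
  by case: (loops al.1) => [|[|[|]]].
have -> : adjacent be.1 al.1 = adjacent al.1 be.1 by rewrite /adjacent orbC.
case: (adjacent _ _) => //=.
have -> : before be al = ~~ before al be.
  move: neq; case: al => a i; case: be => b j; rewrite /before /= xpair_eqE.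
  by rewrite -!val_eqE /=; case: (ltngtP a b) => //= _; case: i; case: j.
by case: before.
Qed.

Lemma big_blocks (M : Type) (idx : M) (op : Monoid.com_law idx) (F : X -> M) :
  \big[op/idx]_al F al =
  \big[op/idx]_(j < m.+2) op (F (inord j, false)) (F (inord j, true)).
Proof.
transitivity (\big[op/idx]_(al : X) F (al.1, al.2)); first by apply: eq_bigr => -[].
rewrite -(pair_bigA _ (fun j i => F (j, i))) /=; apply: eq_bigr => j _.
by rewrite big_bool Monoid.mulmC inord_val.
Qed.

Variables (R : realType) (x : option X -> R).
Let s := \sum_al x (Some al).
Let Y (j : nat) := x (Some (inord j, false)) + x (Some (inord j, true)).
Let sq (j : nat) := x (Some (inord j, false)) ^+ 2 + x (Some (inord j, true)) ^+ 2.

Lemma sum_adjacent :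
  \sum_(al : X) \sum_(be : X) (adjacent al.1 be.1)%:R * (x (Some al) * x (Some be)) =
  2 * \sum_(j < m.+1) Y j * Y j.+1.
Proof.
pose Z := \sum_(i < m.+2) \sum_(j < m.+2) (i.+1 == j :> nat)%:R * (Y i * Y j).
have -> : \sum_(al : X) \sum_(be : X) (adjacent al.1 be.1)%:R * (x (Some al) * x (Some be))
    = Z + Z.
  have {2}-> : Z = \sum_(i < m.+2) \sum_(j < m.+2) (j.+1 == i :> nat)%:R * (Y i * Y j).
    rewrite /Z exchange_big; apply: eq_bigr => i _; apply: eq_bigr => j _.
    by rewrite [Y j * _]mulrC.
  rewrite -big_split big_blocks; apply: eq_bigr => i _ /=.
  rewrite -big_split !big_blocks -big_split; apply: eq_bigr => j _ /=.
  rewrite !inord_val /Y !inord_val /adjacent.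
  have [ij|_] := eqVneq i.+1 j; last by case: (_ == _) => /=; ring.
  by rewrite (_ : (j.+1 == i) = false) /=; [ring | apply/negbTE; lia].
have -> : Z = \sum_(j < m.+1) Y j * Y j.+1; last by ring.
rewrite /Z big_ord_recr /= [X in _ + X]big1 ?addr0 => [|j _]; last first.
  by rewrite gtn_eqF ?mul0r // ltn_ord.
apply: eq_bigr => i _; have iS : (i.+1 < m.+2)%N by rewrite ltnS ltn_ord.
rewrite (bigD1 (Ordinal iS)) //= eqxx mul1r big1 ?addr0 // => j.
by rewrite -val_eqE /= eq_sym => /negbTE ->; rewrite mul0r.
Qed.

(** Since [None] occurs once per triple, the form is [x None] times a quadratic form [Q]; writing
    [Q] as half of [Q + Q] makes [sum_pair_allowed] applicable. *)
Lemma chain_density : palette_density chain_palette x =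
  x None / 2 * (5 * s ^+ 2 + 2 * (\sum_(j < m.+1) Y j * Y j.+1)
    - \sum_(j < m.+2) (5 - 2 * (loops j)%:R) * sq j).
Proof.
pose W al be : R := (\sum_(p < 3) pair_allowed p al be)%N%:R.
pose Q := \sum_al \sum_be W al be * (x (Some al) * x (Some be)).
have -> : palette_density chain_palette x = x None * Q.
  rewrite /palette_density big_option /=.
  under eq_bigr do rewrite big_mkcond big_option /=.
  under [X in _ + X]eq_bigr => al _.
    under eq_bigr do rewrite big_mkcond big_option /=.
    rewrite big_option /= add0r; under [X in _ + X]eq_bigr do rewrite big1_eq addr0.
    rewrite -big_split /=; over.
  rewrite big_option /= big1_eq !add0r -big_split mulr_sumr; apply: eq_bigr => al _ /=.
  rewrite add0r -big_split mulr_sumr; apply: eq_bigr => be _.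
  rewrite /W !big_ord_recr big_ord0 /= add0n !natrD.
  by do 3!case: pair_allowed => /=; ring.
have -> : \sum_(j < m.+2) (5 - 2 * (loops j)%:R) * sq j =
    \sum_(al : X) (5 - 2 * (loops al.1)%:R) * x (Some al) ^+ 2.
  by rewrite big_blocks; apply: eq_bigr => j _ /=; rewrite /sq !inord_val mulrDr.
rewrite -sum_adjacent.
have -> : 5 * s ^+ 2 = \sum_al \sum_be 5 * (x (Some al) * x (Some be)).
  rewrite expr2 mulr_suml mulr_sumr; apply: eq_bigr => al _.
  by rewrite !mulr_sumr.
have -> : \sum_(al : X) (5 - 2 * (loops al.1)%:R) * x (Some al) ^+ 2 =
    \sum_(al : X) \sum_be ((al == be)%:R * (5 - 2 * (loops al.1)%:R)) * (x (Some al) * x (Some be)).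
  apply: eq_bigr => al _; rewrite (bigD1 al) //= eqxx mul1r big1 ?addr0 ?expr2 // => be.
  by rewrite eq_sym => /negbTE ->; rewrite !mul0r.
rewrite -big_split -sumrB -mulrA; congr (_ * _).
have -> : Q = 2^-1 * (Q + Q) by field.
congr (_ * _); rewrite {2}/Q exchange_big -big_split; apply: eq_bigr => al _ /=.
rewrite -!big_split -sumrB; apply: eq_bigr => be _ /=.
have := congr1 (fun n => n%:R : R) (sum_pair_allowed al be).
rewrite big_split /= !natrD !natrM -/(W al be) -/(W be al) => h.
rewrite (_ : W al be = 5 + (adjacent al.1 be.1)%:R + (al == be)%:R * (2 * (loops al.1)%:R)
  - (al == be)%:R * 5 - W be al); last by rewrite -h; ring.
by ring.
Qed.

(** The coefficients are [1], [5], ..., [5], [3]: that is [4] for every block but the first, plus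
    [1] for every block but the last, minus [1] for the last. *)
Lemma chain_squares : \sum_(j < m.+2) (5 - 2 * (loops j)%:R) * Y j ^+ 2 =
  4 * (\sum_(j < m.+1) Y j * Y j.+1)
  + \sum_(j < m.+1) (2 * Y j.+1 - Y j) ^+ 2 - Y m.+1 ^+ 2.
Proof.
have -> : \sum_(j < m.+2) (5 - 2 * (loops j)%:R) * Y j ^+ 2 =
   4 * \sum_(j < m.+1) Y j.+1 ^+ 2 + \sum_(j < m.+1) Y j ^+ 2 - Y m.+1 ^+ 2.
  have -> : \sum_(j < m.+2) (5 - 2 * (loops j)%:R) * Y j ^+ 2 =
    \sum_(j < m.+2) (4 * ((j != 0 :> nat)%N%:R * Y j ^+ 2) + (j != m.+1 :> nat)%:R * Y j ^+ 2
      - (j == m.+1 :> nat)%:R * Y j ^+ 2).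
    apply: eq_bigr => j _; rewrite /loops; have [->|_] := eqVneq (j : nat) 0%N.
      by rewrite /=; ring.
    by case: eqP => _ /=; ring.
  rewrite sumrB big_split /= -mulr_sumr; congr (_ * _ + _ - _).
  - rewrite big_ord_recl /= mul0r add0r; apply: eq_bigr => j _.
    by rewrite mul1r.
  - rewrite big_ord_recr /= eqxx mul0r addr0; apply: eq_bigr => j _.
    by rewrite ltn_eqF // mul1r.
  - rewrite big_ord_recr /= eqxx mul1r big1 ?add0r // => j _.
    by rewrite ltn_eqF // mul0r.
have -> : \sum_(j < m.+1) (2 * Y j.+1 - Y j) ^+ 2 =
    \sum_(j < m.+1) (4 * Y j.+1 ^+ 2 + Y j ^+ 2 - 4 * (Y j * Y j.+1)).
  by apply: eq_bigr => j _; ring.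
by rewrite sumrB big_split /= -!mulr_sumr; ring.
Qed.

(* Y (j+1) = (Y j + (2 Y (j+1) - Y j)) / 2, so each step halves the bound. *)
Lemma last_block_le : Y m.+1 ^+ 2 <=
  \sum_(j < m.+1) (2 * Y j.+1 - Y j) ^+ 2 + 2 ^- m.+1 * Y 0 ^+ 2.
Proof.
move: m.+1 => k; elim: k => [|k IH]; first by rewrite big_ord0 add0r expr0 invr1 mul1r.
rewrite big_ord_recr /= [2 ^+ k.+1]exprS invfM.
have e0 : 0 <= \sum_(j < k) (2 * Y j.+1 - Y j) ^+ 2.
  by apply: sumr_ge0 => j _; apply: sqr_ge0.
have h : Y k.+1 ^+ 2 <= (Y k ^+ 2 + (2 * Y k.+1 - Y k) ^+ 2) / 2.
  have := sqr_ge0 (Y k - (2 * Y k.+1 - Y k)).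
  by move: (Y k) (Y k.+1) => u v; nra.
have := sqr_ge0 (2 * Y k.+1 - Y k).
lra.
Qed.
(** Balancing the two colours of a block only helps, so [chain_squares] and [last_block_le] leave
    [z * s ^ 2 * (5 / 2 + p / 4)] with [z = x None] and [p = 2 ^- m.+1]. Finally
    [z * (1 - z) ^ 2 <= 4 / 27], with equality at [z = 1 / 3]. *)
Lemma chain_density_le : (forall c, 0 <= x c) -> \sum_c x c = 1 ->
  palette_density chain_palette x <= 10 / 27 + 2 ^- m.+3.
Proof.
move=> x0 sx; have s1 : s = 1 - x None by move: sx; rewrite big_option /= -/s; lra.
rewrite chain_density.
have sqle : \sum_(j < m.+2) (5 - 2 * (loops j)%:R) * Y j ^+ 2 <=
    2 * \sum_(j < m.+2) (5 - 2 * (loops j)%:R) * sq j.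
  rewrite mulr_sumr; apply: ler_sum => j _.
  have l2 : 0 <= 5 - 2 * (loops j)%:R :> R.
    have : (loops j <= 2)%N by rewrite /loops; case: ifP => // _; case: (_ == _ :> nat).
    by rewrite -(ler_nat R) => ?; lra.
  rewrite [leRHS]mulrCA; apply: ler_wpM2l => //; rewrite /Y /sq.
  by have := sqr_ge0 (x (Some (inord j, false)) - x (Some (inord j, true))); nra.
have Y0s : Y 0 ^+ 2 <= s ^+ 2.
  rewrite lerXn2r ?nnegrE ?addr_ge0 ?sumr_ge0 // /s big_blocks big_ord_recl lerDl.
  by apply: sumr_ge0 => j _; rewrite addr_ge0.
have p0 : 0 <= 2 ^- m.+1 :> R by rewrite invr_ge0 exprn_ge0.
have p1 : 2 ^- m.+1 <= 1 :> R by rewrite invf_le1 ?exprn_gt0 // exprn_ege1 // ler1n.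
have := last_block_le; have := ler_wpM2l p0 Y0s.
move: sqle; rewrite chain_squares.
have -> : 2 ^- m.+3 = 2 ^- m.+1 / 4 :> R 
  by rewrite -(addn2 m.+1) exprD invfM (_ : 2 ^+ 2 = 4) //; ring.
move: (\sum_(j < m.+1) Y j * Y j.+1) (\sum_(j < m.+1) (_) ^+ 2) (\sum_(j < m.+2) _ * sq j).
move: (Y m.+1 ^+ 2) (Y 0 ^+ 2) (2 ^- m.+1) p0 p1 => yl y0 p p0 p1 a b c h1 h2 h3.
have le : x None / 2 * (5 * s ^+ 2 + 2 * a - c) <= x None / 2 * (5 * s ^+ 2 + p * s ^+ 2 / 2).
  by rewrite ler_wpM2l ?divr_ge0 //; lra.
have s0 : 0 <= s by apply: sumr_ge0.
apply: le_trans le _; have z0 := x0 None; rewrite s1 in s0 *; move: (x None) z0 s0 => z z0 s0.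
have zle : z * (1 - z) ^+ 2 <= 4 / 27.
  rewrite -subr_ge0 (_ : _ - _ = (1 / 3 - z) ^+ 2 * (4 / 3 - z)); last by field.
  by rewrite mulr_ge0 ?sqr_ge0 //; lra.
have := ler_wpM2r p0 zle; nra.
Qed.

End ChainPalette.

(* Up to scaling, weight 2^-j for each colour of block j and total weight 1/3 on None. *)
Definition chain_weight m (c : option ('I_m.+2 * bool)) : nat :=
  if c is Some al then 2 ^ (m.+1 - al.1) else (2 ^ m.+2).-1.

Lemma sum_block_weight m : (\sum_(al : 'I_m.+2 * bool) chain_weight (Some al) =
  2 * (2 ^ m.+2).-1)%N.
Proof.
rewrite big_blocks /=.
under eq_bigr => j _ do rewrite inordK // addnn -mul2n.
rewrite -big_distrr /=; congr (_ * _)%N.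
rewrite (reindex_inj rev_ord_inj) /= predn_exp mul1n; apply: eq_bigr => j _.
by congr (_ ^ _)%N; have := ltn_ord j; lia.
Qed.

(** With balanced blocks and [Y j = 2 * Y j.+1] all squares vanish. Weights [1 / 3] and [2 / 3] give
    [10 / 27], and the surviving last square makes the inequality strict. *)
Lemma chain_palette_dense m (R : realType) :
  exists2 d : R, 10 / 27 < d & admissible_density (uncolorable (@chain_palette m)) d.
Proof.
pose T := (2 ^ m.+2).-1.
have T0 : (0 < T)%N by rewrite -ltnS prednK ?expn_gt0 // -{1}(expn0 2) ltn_exp2l.
have sumE : (\sum_c @chain_weight m c = 3 * T)%N.
  by rewrite big_option sum_block_weight /= -/T; lia.
have [|N [pi wE]] := @exists_colouring R _ (@chain_weight m); first by rewrite sumE muln_gt0.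
exists (palette_density (@chain_palette m) (colour_weight R pi)); last first.
  exact: palette_admissible.
have T0R : 0 < T%:R :> R by rewrite ltr0n.
have {}wE c : colour_weight R pi c = (chain_weight c)%:R / (3 * T%:R).
  by rewrite wE sumE natrM.
have blockE : \sum_al colour_weight R pi (Some al) = 2 / 3.
  under eq_bigr do rewrite wE.
  by rewrite -mulr_suml -natr_sum sum_block_weight natrM; field; rewrite gt_eqF.
pose x := colour_weight R pi.
pose Y (j : nat) := x (Some (inord j, false)) + x (Some (inord j, true)).
have xE (j : nat) b : (j < m.+2)%N -> x (Some (inord j, b)) = 2 ^+ (m.+1 - j) / (3 * T%:R).
  by move=> lt; rewrite /x wE /= inordK // natrX.
have YE (j : nat) : (j < m.+2)%N -> Y j = 2 * (2 ^+ (m.+1 - j) / (3 * T%:R)).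
  by move=> lt; rewrite /Y !xE //; ring.
have xNone : x None = 1 / 3.
  by rewrite /x wE /= -/T; field; rewrite gt_eqF.
rewrite chain_density blockE -/x xNone.
have := chain_squares x; rewrite -/(Y m.+1).
have -> : \sum_(j < m.+1) (2 * Y j.+1 - Y j) ^+ 2 = 0.
  apply: big1 => j _; have lt := ltn_ord j.
  by rewrite !YE ?ltnS ?(ltnW lt) // subSS (subSn (_ : j <= m)%N) // [2 ^+ _.+1]exprS; ring.
have -> : \sum_(j < m.+2) (5 - 2 * (loops m j)%:R) * Y j ^+ 2 =
   2 * \sum_(j < m.+2) (5 - 2 * (loops m j)%:R) *
     (x (Some (inord j, false)) ^+ 2 + x (Some (inord j, true)) ^+ 2).
  rewrite mulr_sumr; apply: eq_bigr => j _.
  by rewrite YE // !xE //; ring.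
have : 0 < Y m.+1 ^+ 2.
  by rewrite exprn_gt0 // YE // mulr_gt0 // divr_gt0 ?exprn_gt0 // mulr_gt0.
move: (Y m.+1 ^+ 2) (\sum_(j < m.+1) _) (\sum_(j < m.+2) _) => y a b y0 h.
lra.
Qed.

(** The exact values are not computed: strictness on the left and convergence on the right already
    show that [10 / 27] is an infimum that is not attained. *)
Lemma pi_vvv_chain (R : realType) m :
  10 / 27 < pi_vvv R (uncolorable (@chain_palette m)) <= 10 / 27 + 2 ^- m.+3.
Proof.
have [d dgt dadm] := chain_palette_dense m R.
apply/andP; split.
  apply: lt_le_trans dgt _; apply: ub_le_sup dadm.
  by exists 1 => e [/andP[]].
apply: ge_sup; first by exists d.
move=> e; apply: admissible_density_le => x x0 sx; exact: chain_density_le.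
Qed.

Theorem theorem1p1 (R : realType) :
  ~ wochoice.wo_chain <=%R (mem (Pi_vvv_infty R)).
Proof.
move/wo_chain_leP => wo.
pose p m := pi_vvv R (uncolorable (@chain_palette m)).
have [_ [m _ <-] mle] : exists2 x, range p x & lbound (range p) x.
  apply: wo; last by exists (p 0%N); exists 0%N.
  by move=> _ [m _ <-]; exists (uncolorable (@chain_palette m)).
have /andP[gt _] := pi_vvv_chain R m; rewrite -/(p m) in gt.
(* [k] is chosen so that [2 ^- k.+3] is smaller than the gap between the supposed minimum [p m] and
   [10 / 27]; hence [p k] lies below [p m]. *)
pose k := Num.truncn (p m - 10 / 27)^-1.
have /andP[_ le] := pi_vvv_chain R k.
have kgt : (p m - 10 / 27)^-1 < 2 ^+ k.+3.
  have le2 j : (j.+1 <= 2 ^ j.+3)%N.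
    by apply: (@leq_trans (2 ^ j.+1)); [exact: ltnW (ltn_expl _ _) | rewrite leq_exp2l //; lia].
  by apply: lt_le_trans (truncnS_gt _) _; rewrite -/k -natrX ler_nat le2.
have lt : 2 ^- k.+3 < p m - 10 / 27.
  by rewrite invf_plt ?posrE ?exprn_gt0 ?subr_gt0.
have mk : p m <= p k by apply: mle; exists k.
by have := le_trans mk le; rewrite -lerBlDl leNgt lt.
Qed.
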